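(* Let $\mathcal{G}=(B,\psi,A)$ be a directed quantum graph such that $\psi$ is a $\delta$-form and $A$ is completely positive, and let $E_{\mathcal{G}}$ be its quantum edge correspondence. Assume that $\ker(A)$ does not contain a central summand of $B$. Then $\mathcal{O}_{E_{\mathcal{G}}}\cong\mathcal{O}(\mathcal{G})/\mathcal{I}$, where $\mathcal{O}_{E_{\mathcal{G}}}$ is the Cuntz--Pimsner algebra of $E_{\mathcal{G}}$, $\mathcal{O}(\mathcal{G})$ is the quantum Cuntz--Krieger algebra of $\mathcal{G}$ with universal family $S\colon B\to\mathcal{O}(\mathcal{G})$, and $\mathcal{I}\triangleleft\mathcal{O}(\mathcal{G})$ is the closed two-sided ideal generated by the local relations (LQCK1), (LQCK2) and (LQCK3) for $S$ (that is, by the differences of the two sides of these relations, evaluated at all elements of their domains).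
   Context: A directed quantum graph $\mathcal{G}=(B,\psi,A)$ consists of a finite-dimensional C*-algebra $B$, a faithful state $\psi$ on $B$ and a linear map $A\colon B\to B$, as follows. Let $m\colon B\otimes B\to B$ be multiplication and $m^*\colon B\to B\otimes B$ its adjoint with respect to the inner products $\langle x,y\rangle_\psi=\psi(x^*y)$ on $B$ and $\langle\cdot,\cdot\rangle_{\psi\otimes\psi}$ on $B\otimes B$. The state $\psi$ is a $\delta$-form ($\delta>0$) if $mm^*=\delta^2\,\mathrm{id}_B$, and $A$ is a quantum adjacency matrix if $m(A\otimes A)m^*=\delta^2A$. A central summand of $B$ is a nonzero direct summand $zB$ with $z$ a central projection. A C*-correspondence over $B$ is a right Hilbert $B$-module $X$ with a $*$-homomorphism $\varphi_X\colon B\to\mathcal{L}(X)$ into the adjointable operators; write $x\cdot\xi=\varphi_X(x)\xi$. $B\otimes_\psi B$ is the C*-correspondence over $B$ with underlying space $B\otimes B$, actions $x\cdot(a\otimes b)\cdot y=(xa)\otimes(by)$ and inner product $\langle a\otimes b,c\otimes d\rangle_B=b^*\psi(a^*c)d$. The quantum edge indicator is $\epsilon_{\mathcal{G}}=\frac{1}{\delta^2}(\mathrm{id}\otimes A)m^*(1_B)\in B\otimes_\psi B$, and the quantum edge correspondence is the subcorrespondence $E_{\mathcal{G}}=\mathrm{span}\{x\cdot\epsilon_{\mathcal{G}}\cdot y: x,y\in B\}$. A representation of a C*-correspondence $X$ over $B$ on a C*-algebra $D$ is a pair $(\pi,t)$ with $\pi\colon B\to D$ a $*$-homomorphism and $t\colon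 X\to D$ linear such that $\pi(x)t(\xi)=t(x\cdot\xi)$ and $t(\xi)^*t(\eta)=\pi(\langle\xi,\eta\rangle_B)$. With $\theta_{\xi,\eta}(\zeta)=\xi\cdot\langle\eta,\zeta\rangle_B$ generating the compact operators $\mathcal{K}(X)$, let $\psi_t\colon\mathcal{K}(X)\to D$ be the $*$-homomorphism with $\psi_t(\theta_{\xi,\eta})=t(\xi)t(\eta)^*$. The representation is covariant if $\pi(x)=\psi_t(\varphi_X(x))$ for all $x\in J_X=\{x\in B:\varphi_X(x)\in\mathcal{K}(X),\ xy=0\ \forall y\in\ker\varphi_X\}$. The Cuntz--Pimsner algebra is $\mathcal{O}_X=C^*(\pi_X(B),t_X(X))$ where $(\pi_X,t_X)$ is the universal covariant representation. For a linear map $s\colon B\to D$ into a unital C*-algebra, let $\mu_D\colon D\otimes D\to D$ be the multiplication and $s^*(b):=s(b^* )^*$. The map $s$ is a quantum Cuntz--Krieger $\mathcal{G}$-family if (QCK1) $\mu_D(\mu_D\otimes1)(s\otimes s^*\otimes s)(m^*\otimes1)m^*=s$; (QCK2) $\mu_D(s^*\otimes s)m^*=\mu_D(s\otimes s^* )m^*A$; (QCK3) $\mu_D(s\otimes s^* )m^*(1_B)=\frac{1}{\delta^2}1_D$. The quantum Cuntz--Krieger algebra $\mathcal{O}(\mathcal{G})$ is the universal unital C*-algebra generated by the image of a quantum Cuntz--Krieger $\mathcal{G}$-family $S\colon B\to\mathcal{O}(\mathcal{G})$. The local relations for $s$ are: (LQCK1) $\mu_D(\mu_D\otimes1)(s\otimes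 s^*\otimes s)(m^*\otimes1)=\frac{1}{\delta^2}sm$ on $B\otimes B$; (LQCK2) $\mu_D(s^*\otimes s)=\frac{1}{\delta^2}\mu_D(s\otimes s^* )m^*Am$ on $B\otimes B$; (LQCK3) $\mu_D(s\otimes s^* )m^*(1_B)=\frac{1}{\delta^2}1_D$. *)

(* Defs.v *)
From HB Require Import structures.
From mathcomp Require Import all_boot all_order all_algebra.
From mathcomp Require Import all_classical all_reals all_analysis.
From mathcomp Require Import complex.
Set Implicit Arguments.
Unset Strict Implicit.
Unset Printing Implicit Defensive.
Import Order.TTheory GRing.Theory Num.Theory numFieldNormedType.Exports.
Local Open Scope classical_set_scope.
Local Open Scope ring_scope.

Reserved Notation "x ** y" (at level 40, left associativity).
Reserved Notation "U ⊗ V" (at level 40, left associativity).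

(* C*-algebras need not be unital, so the product is a new operation and not *)
(* the product of a ring structure. The norm is the one of normedModType,     *)
(* with values in the nonnegative elements of R[i].                           *)
HB.mixin Record isCstarAlgebra (R : realType) A
    of CompleteNormedModule R[i] A := {
  cmul : A -> A -> A;
  star : A -> A;
  cmulA : associative cmul;
  cmulDl : left_distributive cmul +%R;
  cmulDr : right_distributive cmul +%R;
  cmulZl : forall (a : R[i]) (x y : A), cmul (a *: x) y = a *: cmul x y;
  cmulZr : forall (a : R[i]) (x y : A), cmul x (a *: y) = a *: cmul x y;
  starD : {morph star : x y / x + y};
  starZ : forall (a : R[i]) (x : A), star (a *: x) = a^* *: star x;
  starK : involutive star;
  starM : forall x y : A, star (cmul x y) = cmul (star y) (star x);
  norm_cmul : forall x y : A, `|cmul x y| <= `|x| * `|y|;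
  norm_cstar : forall x : A, `|cmul (star x) x| = `|x| ^+ 2 }.

#[short(type="cstarType")]
HB.structure Definition CstarAlgebra (R : realType) :=
  {A of isCstarAlgebra R A & CompleteNormedModule R[i] A}.

Notation "x ** y" := (cmul x y) : ring_scope.

(* The zero algebra, where cone = 0, is a unital C*-algebra. *)
HB.mixin Record isUnitalCstar (R : realType) A of CstarAlgebra R A := {
  cone : A;
  cmul1l : left_id cone cmul;
  cmul1r : right_id cone cmul }.

#[short(type="unitalCstarType")]
HB.structure Definition UnitalCstar (R : realType) :=
  {A of isUnitalCstar R A & CstarAlgebra R A}.

(* A finite-dimensional C*-algebra always has a unit. *)
#[short(type="finCstarType")]
HB.structure Definition FinCstar (R : realType) :=
  {A of UnitalCstar R A & Vector R[i] A}.

Section CstarAlgebras.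
Variable R : realType.
Local Notation C := R[i].

Definition star_hom (A D : cstarType R) (f : A -> D) : Prop :=
  [/\ linear f, {morph f : x y / x ** y} & {morph f : x / star x}].

Definition cstar_iso (A D : cstarType R) : Prop :=
  exists f : A -> D, star_hom f /\ bijective f.

Definition cstar_subalgebra (A : cstarType R) (V : set A) : Prop :=
  [/\ closed V, V 0,
      forall (a : C) x y, V x -> V y -> V (a *: x + y),
      forall x y, V x -> V y -> V (x ** y)
    & forall x, V x -> V (star x)].

Definition cstar_generated (A : cstarType R) (X : set A) : set A :=
  smallest (@cstar_subalgebra A) X.

Definition closed_ideal (A : cstarType R) (V : set A) : Prop :=
  [/\ closed V, V 0,
      forall (a : C) x y, V x -> V y -> V (a *: x + y)
    & forall x y, V y -> V (x ** y) /\ V (y ** x)].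

Definition generated_closed_ideal (A : cstarType R) (X : set A) : set A :=
  smallest (@closed_ideal A) X.

(* (Q, q) is the quotient C*-algebra A / I with its quotient map; the norm of *)
(* Q is then the quotient norm, as is the case for any such *-homomorphism.   *)
Definition is_quotient (A : cstarType R) (I : set A) (Q : cstarType R)
    (q : A -> Q) : Prop :=
  [/\ star_hom q, forall y, exists x, q x = y & forall x, q x = 0 <-> I x].

End CstarAlgebras.

(* The tensor product of two finite-dimensional spaces is the space of        *)
(* coefficient matrices with respect to the tensors e_i ⊗ f_j of the bases    *)
(* vbasis fullv.                                                              *)
Definition tensor (K : fieldType) (U V : vectType K) : Type :=
  'M[K]_(\dim {:U}, \dim {:V}).
HB.instance Definition _ (K : fieldType) (U V : vectType K) :=
  Vector.on (tensor U V).
Notation "U ⊗ V" := (tensor U V) : type_scope.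

Section Tensor.
Variable K : fieldType.
Implicit Types U V : vectType K.

Definition tens U V (u : U) (v : V) : U ⊗ V :=
  \matrix_(i, j) (coord (vbasis {:U}) i u * coord (vbasis {:V}) j v).

(* The linear map on U ⊗ V induced by a bilinear map f. *)
Definition tlift U V (W : lmodType K) (f : U -> V -> W) (T : U ⊗ V) : W :=
  \sum_i \sum_j (T i j : K) *: f (vbasis {:U})`_i (vbasis {:V})`_j.

Definition tmap U V U' V' (f : U -> U') (g : V -> V') : U ⊗ V -> U' ⊗ V' :=
  tlift (fun u v => tens (f u) (g v)).

Lemma linear_comb (V W : lmodType K) (h : V -> W) (I : Type) (r : seq I)
    (c : I -> K) (F : I -> V) : linear h ->
  h (\sum_(i <- r) c i *: F i) = \sum_(i <- r) c i *: h (F i).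
Proof.
move=> lh; elim/big_rec2 : _ => [|i x y _ <-]; last exact: lh.
by rewrite -[X in h X](addNr 0) -scaleN1r lh scaleN1r addNr.
Qed.

Lemma linear_scale (V W : lmodType K) (h : V -> W) (c : K) (v : V) :
  linear h -> h (c *: v) = c *: h v.
Proof.
move=> lh; have := linear_comb [:: tt] (fun=> c) (fun=> v) lh.
by rewrite !big_seq1.
Qed.

Lemma linear_bigsum (V W : lmodType K) (h : V -> W) (I : Type) (r : seq I)
    (F : I -> V) : linear h ->
  h (\sum_(i <- r) F i) = \sum_(i <- r) h (F i).
Proof.
move=> lh; have E (L : lmodType K) (G : I -> L) :
    \sum_(i <- r) G i = \sum_(i <- r) 1 *: G i.
  by apply: eq_bigr => i _; rewrite scale1r.
by rewrite [in LHS]E [RHS]E (linear_comb _ _ _ lh).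
Qed.

Lemma tliftE U V (W : lmodType K) (f : U -> V -> W) u v :
  (forall u, linear (f u)) -> (forall v, linear (f^~ v)) ->
  tlift f (tens u v) = f u v.
Proof.
move=> fr fl; rewrite [X in _ = f X _](coord_vbasis (memvf u)).
rewrite (linear_comb _ _ _ (fl v)); apply: eq_bigr => i _.
rewrite [X in _ = _ *: f _ X](coord_vbasis (memvf v)).
rewrite (linear_comb _ _ _ (fr _)) scaler_sumr; apply: eq_bigr => j _.
by rewrite scalerA mxE.
Qed.

Lemma tlift_linear U V (W : lmodType K) (f : U -> V -> W) : linear (tlift f).
Proof.
move=> a S T; rewrite /tlift scaler_sumr -big_split; apply: eq_bigr => i _.
rewrite scaler_sumr -big_split; apply: eq_bigr => j _.
by rewrite !mxE scalerDl scalerA.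
Qed.

Lemma tens_linearr U V (u : U) : linear (fun v : V => tens u v).
Proof.
by move=> a v w; apply/matrixP => i j; rewrite !mxE linearP /= mulrDr mulrCA.
Qed.

Lemma tens_linearl U V (v : V) : linear (fun u : U => tens u v).
Proof.
by move=> a u w; apply/matrixP => i j; rewrite !mxE linearP /= mulrDl mulrA.
Qed.

End Tensor.

(* The conjugate-linear map on U ⊗ V induced by a map f that is               *)
(* conjugate-linear in both variables.                                        *)
Definition tliftc (R : realType) (U V : vectType R[i]) (W : lmodType R[i])
    (f : U -> V -> W) (T : U ⊗ V) : W :=
  \sum_i \sum_j (T i j : R[i])^* *: f (vbasis {:U})`_i (vbasis {:V})`_j.

Lemma tliftcE (R : realType) (U V : vectType R[i]) (W : lmodType R[i])
    (f : U -> V -> W) u v :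
  (forall (a : R[i]) x y z, f (a *: x + y) z = a^* *: f x z + f y z) ->
  (forall (a : R[i]) x y z, f z (a *: x + y) = a^* *: f z x + f z y) ->
  tliftc f (tens u v) = f u v.
Proof.
move=> fl fr.
have comb (V' : vectType R[i]) (h : V' -> W) :
    (forall (a : R[i]) x y, h (a *: x + y) = a^* *: h x + h y) ->
    forall n (c : 'I_n -> R[i]) (F : 'I_n -> V'),
    h (\sum_i c i *: F i) = \sum_i (c i)^* *: h (F i).
  move=> lh n c F; elim/big_rec2 : _ => [|i x y _ <-]; last exact: lh.
  by rewrite -[X in h X](addNr 0) -scaleN1r lh rmorphN1 scaleN1r addNr.
rewrite [X in _ = f X _](coord_vbasis (memvf u)).
rewrite (comb _ (f^~ v)) => [|a x y]; last exact: fl.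
apply: eq_bigr => i _; rewrite [X in _ = _ *: f _ X](coord_vbasis (memvf v)).
rewrite (comb _ (f _)) => [|a x y]; last exact: fr.
rewrite scaler_sumr; apply: eq_bigr => j _.
by rewrite scalerA mxE rmorphM.
Qed.

Lemma tmap_comp (K : fieldType) (U V U' V' U'' V'' : vectType K)
    (f : U -> U') (g : V -> V') (f' : U' -> U'') (g' : V' -> V'') (T : U ⊗ V) :
  linear f' -> linear g' ->
  tmap f' g' (tmap f g T) = tmap (f' \o f) (g' \o g) T.
Proof.
move=> lf lg; have lfg := @tlift_linear _ _ _ _ (fun u v => tens (f' u) (g' v)).
have E a b : tmap f' g' (tens a b) = tens (f' a) (g' b).
  by apply: tliftE => [u a' x y|v a' x y];
    rewrite (lf, lg) (tens_linearl, tens_linearr).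
rewrite {2}/tmap {1}/tlift [LHS](linear_bigsum _ _ lfg); apply: eq_bigr => i _.
by rewrite [LHS](linear_comb _ _ _ lfg); apply: eq_bigr => j _; rewrite -E.
Qed.

Section QuantumGraphs.
Variables (R : realType) (B : finCstarType R).
Local Notation C := R[i].
Implicit Types (psi : {scalar B}) (A : B -> B) (delta : R).

Definition faithful_state psi : Prop :=
  [/\ forall x, 0 <= psi (star x ** x), psi (cone : B) = 1
    & forall x, psi (star x ** x) = 0 -> x = 0].

Definition tmul : B ⊗ B -> B := tlift (fun a b => a ** b).

Definition ip psi (x y : B) : C := psi (star x ** y).

(* <a ⊗ b, c ⊗ d> = psi(a^* c) psi(b^* d). *)
Definition tip psi (S T : B ⊗ B) : C :=
  tliftc (fun a b => tlift (fun c d => ip psi a c * ip psi b d : C^o) T) S.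

(* m^*(x) is the unique T with <S, T> = <m S, x> for all S; when psi is       *)
(* a faithful state it exists (comulP) and is unique.                         *)
Definition comul psi (x : B) : B ⊗ B :=
  xget 0 [set T | forall S, tip psi S T = ip psi (tmul S) x].

Definition delta_form psi delta : Prop :=
  forall x, tmul (comul psi x) = (delta%:C%C ^+ 2) *: x.

Definition quantum_adjacency psi delta A : Prop :=
  forall x, tmul (tmap A A (comul psi x)) = (delta%:C%C ^+ 2) *: A x.

(* The positive elements Y^* Y of the C*-algebra M_n(B). *)
Definition mx_positive n (X : 'M[B]_n) : Prop :=
  exists Y : 'M[B]_n, X = \matrix_(i, j) \sum_k (star (Y k i) ** Y k j).

Definition completely_positive A : Prop :=
  forall n (X : 'M[B]_n), mx_positive X -> mx_positive (map_mx A X).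

Definition central_projection (z : B) : Prop :=
  [/\ z ** z = z, star z = z & forall x, z ** x = x ** z].

(* z B is nonzero if and only if z is. *)
Definition ker_contains_central_summand A : Prop :=
  exists z, [/\ central_projection z, z <> 0 & forall x, A (z ** x) = 0].

End QuantumGraphs.

Section Comul.
Variables (R : realType) (B : finCstarType R) (psi : {scalar B}).
Local Notation C := R[i].
Local Notation e := (vbasis {:B}).

Lemma tip_deltaE (i j : 'I_(\dim {:B})) (T : B ⊗ B) :
  tip psi (delta_mx i j) T =
  \sum_k \sum_l T k l * (ip psi e`_i e`_k * ip psi e`_j e`_l).
Proof.
rewrite /tip /tliftc (bigD1 i) //= (bigD1 j) //= !mxE !eqxx rmorph1 scale1r.
rewrite big1 ?addr0 => [|l lj]; last by rewrite mxE (negPf lj) andbF rmorph0 scale0r.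
rewrite big1 ?addr0 // => k ki; rewrite big1 // => l _.
by rewrite mxE (negPf ki) rmorph0 scale0r.
Qed.

Lemma tipE (S T : B ⊗ B) :
  tip psi S T = \sum_i \sum_j (S i j)^* * tip psi (delta_mx i j) T.
Proof.
by apply: eq_bigr => i _; apply: eq_bigr => j _; rewrite tip_deltaE.
Qed.

Lemma cmul_sumr (I : Type) (r : seq I) (a : B) (f : I -> B) :
  a ** (\sum_(i <- r) f i) = \sum_(i <- r) a ** f i.
Proof.
have h0 : a ** 0 = 0 by have := cmulZr 0 a 0; rewrite !scale0r.
by elim: r => [|i r IH]; rewrite ?big_nil ?big_cons ?cmulDr ?IH.
Qed.

Lemma star_sum (I : Type) (r : seq I) (f : I -> B) :
  star (\sum_(i <- r) f i) = \sum_(i <- r) star (f i).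
Proof.
have h0 : star (0 : B) = 0 by have := starZ 0 (0 : B); rewrite rmorph0 !scale0r.
by elim: r => [|i r IH]; rewrite ?big_nil ?big_cons ?starD ?IH.
Qed.

Lemma cmul_suml (I : Type) (r : seq I) (a : B) (f : I -> B) :
  (\sum_(i <- r) f i) ** a = \sum_(i <- r) f i ** a.
Proof.
have h0 : 0 ** a = 0 by have := cmulZl 0 0 a; rewrite !scale0r.
by elim: r => [|i r IH]; rewrite ?big_nil ?big_cons ?cmulDl ?IH.
Qed.

Lemma ip_suml (I : Type) (r : seq I) (f : I -> B) (c : I -> C) y :
  ip psi (\sum_(i <- r) c i *: f i) y = \sum_(i <- r) (c i)^* * ip psi (f i) y.
Proof.
rewrite /ip star_sum cmul_suml linear_sum; apply: eq_bigr => i _.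
by rewrite starZ cmulZl linearZ.
Qed.

Lemma ip_sumr (I : Type) (r : seq I) (f : I -> B) (c : I -> C) x :
  ip psi x (\sum_(i <- r) c i *: f i) = \sum_(i <- r) c i * ip psi x (f i).
Proof.
rewrite /ip cmul_sumr linear_sum; apply: eq_bigr => i _.
by rewrite cmulZr linearZ.
Qed.

Hypothesis psi_state : faithful_state psi.

Lemma ip_nondeg y : (forall i : 'I_(\dim {:B}), ip psi e`_i y = 0) -> y = 0.
Proof.
move=> h; case: psi_state => _ _; apply; rewrite -/(ip psi y y).
rewrite [X in ip psi X _](coord_vbasis (memvf y)) ip_suml big1 // => i _.
by rewrite h mulr0.
Qed.

Lemma vbasis_coef0 (c : 'I_(\dim {:B}) -> C) :
  \sum_i c i *: e`_i = 0 -> forall i, c i = 0.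
Proof. by apply/freeP; apply: basis_free (vbasisP _). Qed.

Lemma tip_nondeg (T : B ⊗ B) :
  (forall i j, tip psi (delta_mx i j) T = 0) -> T = 0.
Proof.
move=> h; apply/matrixP => k l; rewrite mxE.
suff H (j k' : 'I_(\dim {:B})) : \sum_l T k' l * ip psi e`_j e`_l = 0.
  apply: (vbasis_coef0 (c := fun l => T k l)); apply: ip_nondeg => j.
  by rewrite ip_sumr H.
move: k'; apply: vbasis_coef0; apply: ip_nondeg => i.
rewrite ip_sumr -[RHS](h i j) tip_deltaE; apply: eq_bigr => m _.
rewrite mulr_suml; apply: eq_bigr => p _.
by rewrite -mulrA; congr (_ * _); rewrite mulrC.
Qed.

Lemma comulP x S : tip psi S (comul psi x) = ip psi (tmul S) x.
Proof.
rewrite /comul; case: xgetP => [T -> /(_ S)//|] /= N; exfalso.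
pose g (T : B ⊗ B) : 'M[C]_(\dim {:B}, \dim {:B}) :=
  \matrix_(i, j) tip psi (delta_mx i j) T.
have gl : linear g.
  move=> a T T'; apply/matrixP => i j; rewrite !mxE !tip_deltaE mulr_sumr.
  rewrite -big_split; apply: eq_bigr => k _ /=.
  rewrite mulr_sumr -big_split; apply: eq_bigr => l _ /=.
  by rewrite !mxE mulrDl -!mulrA.
pose gm := GRing.isLinear.Build _ _ _ _ _ gl.
pose gL : {linear 'M[C]_(\dim {:B}, \dim {:B}) -> 'M[C]_(\dim {:B}, \dim {:B})} := HB.pack (g : 'M[C]_(\dim {:B}, \dim {:B}) -> _) gm.
have ker : lker (linfun gL) == 0%VS.
  apply/lker0P => T T'; rewrite !lfunE => E; apply/eqP; rewrite -subr_eq0.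
  apply/eqP/tip_nondeg => i j.
  have /matrixP/(_ i j) : gL (T - T') = 0 by rewrite linearB; apply/eqP; rewrite subr_eq0; apply/eqP.
  by rewrite !mxE.
pose W : 'M[C]_(\dim {:B}, \dim {:B}) :=
  \matrix_(i, j) ip psi (e`_i ** e`_j) x.
have gT : gL ((linfun gL)^-1%VF W) = W by rewrite -lfunE lker0_lfunVK.
apply: (N ((linfun gL)^-1%VF W)) => S'.
rewrite tipE /tmul /tlift /ip star_sum cmul_suml linear_sum.
apply: eq_bigr => i _; rewrite star_sum cmul_suml linear_sum.
apply: eq_bigr => j _; move/matrixP: gT => /(_ i j); rewrite !mxE => ->.
by rewrite starZ cmulZl linearZ.
Qed.
End Comul.

Section Correspondences.
Variables (R : realType) (B : cstarType R).
Local Notation C := R[i].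

(* Only the operations of a finite-dimensional C*-correspondence over B: the  *)
(* notions below are applied to edge_correspondence, which satisfies the      *)
(* axioms of a Hilbert bimodule.                                              *)
Record correspondence := Correspondence {
  corr_space :> vectType C;
  lact : B -> corr_space -> corr_space;
  ract : corr_space -> B -> corr_space;
  corr_ip : corr_space -> corr_space -> B }.

Variable X : correspondence.

Definition theta (xi eta : X) : X -> X := fun zeta => ract xi (corr_ip eta zeta).

(* As X is finite-dimensional, the linear span of the operators theta is      *)
(* closed.                                                                    *)
Definition compact_op : set (X -> X) :=
  [set T | exists n (xi eta : 'I_n -> X), T = \sum_i theta (xi i) (eta i)].

Definition adjoint_of (T T' : X -> X) : Prop :=
  forall xi eta, corr_ip (T xi) eta = corr_ip xi (T' eta).

Definition katsura_ideal : set B :=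
  [set x | compact_op (lact x) /\
           forall y, (forall xi : X, lact y xi = 0) -> x ** y = 0].

Section Representations.
Variables (D : cstarType R) (pi : B -> D) (t : X -> D).

Definition is_representation : Prop :=
  [/\ star_hom pi, linear t,
      forall x xi, pi x ** t xi = t (lact x xi)
    & forall xi eta, star (t xi) ** t eta = pi (corr_ip xi eta)].

(* psi_t is only meaningful on the compact operators.                         *)
Definition is_psi_t (psi_t : (X -> X) -> D) : Prop :=
  [/\ forall (a : C) T T', compact_op T -> compact_op T' ->
        psi_t (a *: T + T') = a *: psi_t T + psi_t T',
      forall T T', compact_op T -> compact_op T' ->
        psi_t (T \o T') = psi_t T ** psi_t T',
      forall T T', compact_op T -> compact_op T' -> adjoint_of T T' ->
        psi_t T' = star (psi_t T)
    & forall xi eta, psi_t (theta xi eta) = t xi ** star (t eta)].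

Definition is_covariant : Prop :=
  exists2 psi_t, is_psi_t psi_t
    & forall x, katsura_ideal x -> pi x = psi_t (lact x).

End Representations.

Definition is_cuntz_pimsner (O : cstarType R) (piX : B -> O) (tX : X -> O) :
    Prop :=
  [/\ is_representation piX tX, is_covariant piX tX,
      cstar_generated (range piX `|` range tX) = setT
    & forall (D : cstarType R) (pi : B -> D) (t : X -> D),
        is_representation pi t -> is_covariant pi t ->
        exists! rho : O -> D, [/\ star_hom rho, rho \o piX = pi & rho \o tX = t]].

End Correspondences.

Section QuantumEdgeCorrespondence.
Variables (R : realType) (B : finCstarType R) (psi : {scalar B}) (A : B -> B).
Variable delta : R.

Definition tens_lact (x : B) : B ⊗ B -> B ⊗ B := tmap (fun a => x ** a) id.
Definition tens_ract (T : B ⊗ B) (y : B) : B ⊗ B :=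
  tmap id (fun b => b ** y) T.

(* <a ⊗ b, c ⊗ d>_B = b^* psi(a^* c) d. *)
Definition tens_ip (S T : B ⊗ B) : B :=
  tliftc (fun a b => tlift (fun c d => psi (star a ** c) *: (star b ** d)) T) S.

Definition edge_indicator : B ⊗ B :=
  (delta%:C%C ^- 2) *: tmap id A (comul psi cone).

(* By bilinearity the span of all x . eps . y is spanned by the x . eps . y   *)
(* with x and y in a basis; see mem_edge_space.                               *)
Definition edge_space : {vspace B ⊗ B} :=
  <<[seq tens_ract (tens_lact x edge_indicator) y
      | x <- vbasis {:B}, y <- vbasis {:B}]>>%VS.

(* vsproj casts back to the subspace, which is stable under both actions      *)
(* (edge_space_lact, edge_space_ract).                                        *)
Definition edge_correspondence : correspondence B :=
  @Correspondence R B (subvs_of edge_space)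
    (fun x xi => vsproj edge_space (tens_lact x (vsval xi)))
    (fun xi y => vsproj edge_space (tens_ract (vsval xi) y))
    (fun xi eta => tens_ip (vsval xi) (vsval eta)).

End QuantumEdgeCorrespondence.

Section Edge.
Variables (R : realType) (B : finCstarType R) (psi : {scalar B}) (A : B -> B).
Variable delta : R.
Local Notation eps := (edge_indicator psi A delta).
Local Notation E := (edge_space psi A delta).
Local Notation C := R[i].

Lemma tens_lact_linear (x : B) : linear (tens_lact x).
Proof. exact: tlift_linear. Qed.

Lemma tens_ract_linear (y : B) : linear (fun T : B ⊗ B => tens_ract T y).
Proof. exact: tlift_linear. Qed.

Lemma tens_lact_linearl (T : B ⊗ B) : linear (fun x => tens_lact x T).
Proof.
move=> a x y; rewrite /tens_lact /tmap /tlift scaler_sumr -big_split.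
apply: eq_bigr => i _; rewrite scaler_sumr -big_split; apply: eq_bigr => j _ /=.
by rewrite cmulDl cmulZl tens_linearl scalerDr !scalerA mulrC.
Qed.

Lemma tens_ract_linearr (T : B ⊗ B) : linear (tens_ract T).
Proof.
move=> a x y; rewrite /tens_ract /tmap /tlift scaler_sumr -big_split.
apply: eq_bigr => i _; rewrite scaler_sumr -big_split; apply: eq_bigr => j _ /=.
by rewrite cmulDr cmulZr tens_linearr scalerDr !scalerA mulrC.
Qed.

Lemma cmul_linearr (x : B) : linear (fun a : B => x ** a).
Proof. by move=> a u v; rewrite cmulDr cmulZr. Qed.

Lemma cmul_linearl (y : B) : linear (fun a : B => a ** y).
Proof. by move=> a u v; rewrite cmulDl cmulZl. Qed.

Let linear_id : linear (@id B). Proof. by []. Qed.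

Lemma tens_lactM (x y : B) T :
  tens_lact x (tens_lact y T) = tens_lact (x ** y) T.
Proof.
rewrite /tens_lact (tmap_comp _ _ _ (cmul_linearr x) linear_id).
by congr (tmap _ _ T); apply/funext => b /=; rewrite cmulA.
Qed.

Lemma tens_ractM (x y : B) T :
  tens_ract (tens_ract T x) y = tens_ract T (x ** y).
Proof.
rewrite /tens_ract (tmap_comp _ _ _ linear_id (cmul_linearl y)).
by congr (tmap _ _ T); apply/funext => b /=; rewrite cmulA.
Qed.

Lemma tens_lract (x y : B) T :
  tens_lact x (tens_ract T y) = tens_ract (tens_lact x T) y.
Proof.
rewrite /tens_lact /tens_ract (tmap_comp _ _ _ (cmul_linearr x) linear_id).
by rewrite (tmap_comp _ _ _ linear_id (cmul_linearl y)).
Qed.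

Lemma mem_edge_space (T : B ⊗ B) :
  T \in E <-> exists n (x y : 'I_n -> B),
    T = \sum_k tens_ract (tens_lact (x k) eps) (y k).
Proof.
split=> [|[n [x [y ->]]]].
  have gen (s : seq (B ⊗ B)) :
      {in s, forall w, exists xy : B * B,
         w = tens_ract (tens_lact xy.1 eps) xy.2} ->
      T \in span s -> exists n (x y : 'I_n -> B),
        T = \sum_k tens_ract (tens_lact (x k) eps) (y k).
    move=> sP /(@coord_span _ _ _ (in_tuple s)) TE.
    have [g gE] := choice (fun i : 'I_(size s) => sP _ (mem_nth 0 (ltn_ord i))).
    pose c i := coord (in_tuple s) i T.
    exists (size s), (fun i => c i *: (g i).1), (fun i => (g i).2).
    rewrite TE; apply: eq_bigr => i _; rewrite -/(c i) gE.
    by rewrite (linear_scale _ _ (tens_lact_linearl eps))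
      (linear_scale _ _ (tens_ract_linear _)).
  apply: gen => w /allpairsP[xy [_ _ ->]]; by exists xy.
apply: memv_suml => k _.
rewrite (coord_vbasis (memvf (x k))) (linear_comb _ _ _ (tens_lact_linearl _)).
rewrite (linear_comb _ _ _ (tens_ract_linear _)); apply: memv_suml => i _.
apply: memvZ.
rewrite (coord_vbasis (memvf (y k))) (linear_comb _ _ _ (tens_ract_linearr _)).
apply: memv_suml => j _; apply: memvZ; apply: memv_span.
by apply: allpairs_f; apply: mem_nth; rewrite size_tuple ltn_ord.
Qed.

Lemma edge_space_lact x T : T \in E -> tens_lact x T \in E.
Proof.
move=> /mem_edge_space[n [u [v ->]]]; apply/mem_edge_space.
exists n, (fun k => x ** u k), v.
rewrite (linear_bigsum _ _ (tens_lact_linear x)); apply: eq_bigr => k _.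
by rewrite tens_lract tens_lactM.
Qed.

Lemma edge_space_ract y T : T \in E -> tens_ract T y \in E.
Proof.
move=> /mem_edge_space[n [u [v ->]]]; apply/mem_edge_space.
exists n, u, (fun k => v k ** y).
rewrite (linear_bigsum _ _ (tens_ract_linear y)); apply: eq_bigr => k _.
by rewrite tens_ractM.
Qed.
End Edge.

Section CuntzKriegerFamilies.
Variables (R : realType) (B : finCstarType R) (psi : {scalar B}) (A : B -> B).
Variable delta : R.

Section Family.
Variables (D : unitalCstarType R) (s : B -> D).

Definition sstar (b : B) : D := star (s (star b)).

(* mu_D (f ⊗ g) and mu_D (mu_D ⊗ 1) (f ⊗ g ⊗ h), as maps on B ⊗ B             *)
(* and (B ⊗ B) ⊗ B.                                                           *)
Definition mu2 (f g : B -> D) : B ⊗ B -> D := tlift (fun a b => f a ** g b).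
Definition mu3 (f g h : B -> D) : (B ⊗ B) ⊗ B -> D :=
  tlift (fun T c => mu2 f g T ** h c).

Local Notation m_ := (@tmul R B).
Local Notation ms := (comul psi).
Local Notation ms1 := (tmap (comul psi) (@id B)).
Local Notation d2 := (delta%:C%C ^- 2).

Definition qck_family : Prop :=
  [/\ linear s,
      forall x, mu3 s sstar s (ms1 (ms x)) = s x,
      forall x, mu2 sstar s (ms x) = mu2 s sstar (ms (A x))
    & mu2 s sstar (ms cone) = d2 *: cone].

Definition lqck1_defect (T : B ⊗ B) : D :=
  mu3 s sstar s (ms1 T) - d2 *: s (m_ T).
Definition lqck2_defect (T : B ⊗ B) : D :=
  mu2 sstar s T - d2 *: mu2 s sstar (ms (A (m_ T))).
Definition lqck3_defect : D := mu2 s sstar (ms cone) - d2 *: cone.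

Definition local_relation_ideal : set D :=
  generated_closed_ideal
    (range lqck1_defect `|` range lqck2_defect `|` [set lqck3_defect]).

End Family.

Definition is_quantum_cuntz_krieger (O : unitalCstarType R) (S : B -> O) :
    Prop :=
  [/\ qck_family S,
      cstar_generated (range S `|` [set cone]) = setT
    & forall (D : unitalCstarType R) (s : B -> D), qck_family s ->
        exists! rho : O -> D,
          [/\ star_hom rho, rho cone = cone & rho \o S = s]].

End CuntzKriegerFamilies.

(* Main.v *)
Require Import Defs.
From HB Require Import structures.
From mathcomp Require Import all_boot all_order all_algebra.
From mathcomp Require Import all_classical all_reals all_analysis.
From mathcomp Require Import complex.
From mathcomp Require Import ring.

(* By quantum adjacency <eps, x . eps> = delta^-2 A(x), and if m^* (1) is      *)
(* sum_i a_i ⊗ b_i then the a_i . eps and b_i^* . eps form a frame of E_G:     *)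
(* xi = sum_i a_i . eps . <b_i^* . eps, xi>. As ker A contains no central      *)
(* summand, B acts faithfully on E_G, so covariance of (pi, t) says that       *)
(* sum_i pi(a_i) t(eps) t(eps)^* pi(b_i) = 1. Hence s(x) = delta^-1 t(x . eps) *)
(* satisfies the local relations; conversely a local family s gives            *)
(* pi(x) = delta^2 mu (s ⊗ s^* ) m^* (x), t(x . eps . y) = delta s(x) pi(y).   *)
(* These correspondences yield rho : O_E -> O(G)/I and rho' : O(G) -> O_E with *)
(* rho \o rho' = q. For rho' to factor through q its kernel must be closed:    *)
(* unital *-homomorphisms are bounded because a small self-adjoint h has a     *)
(* self-adjoint k commuting with it such that h^2 + k^2 = 1, and then h is the *)
(* real part of the unitary h + i k, whose image is again a unitary.           *)

Set Implicit Arguments.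
Unset Strict Implicit.
Unset Printing Implicit Defensive.
Import Order.TTheory GRing.Theory Num.Theory numFieldNormedType.Exports.
Local Open Scope classical_set_scope.
Local Open Scope ring_scope.

(** * Closed sets and fixed points *)

(** Everything rests on a dual frame: if m^* (1) is the sum of the a_i ⊗ b_i, then (a_i) and (b_i)
    are dual for the form psi (x y). Identities in B ⊗ B then reduce to two moves:
    [dual_frame_move], saying that m^* is a bimodule map, and [dual_frame_flip], saying that m^* (1)
    is invariant under a ⊗ b -> b^* ⊗ a^* . With quantum adjacency they yield the inner products
    [edge_ip] and the reconstruction formula [edge_frame].

    The frame makes the left action a finite sum of [theta] operators ([edge_lact_theta]), and
    [ideal_kernel_eq0] makes it faithful, so the Katsura ideal is B and covariance becomes one
    formula, [covariant_frame]. Unital covariant representations of E_G and local families then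
    determine each other ([local_representation], [local_covariant], [representation_local_family]).

    By m m^* = delta^2 a local family is a quantum Cuntz-Krieger family ([local_family_qck]), so
    O(G)/I is universal for local families. [unital_quotient_iso] plays the two universal properties
    against each other; the main analytic input is [closed_star_hom_kernel]. *)

Section Topology.
Variable R : realType.
Local Notation C := R[i].

Lemma complex_half_geometric_small (d e : C) : 0 <= d -> 0 < e ->
  exists N, forall n, (N <= n)%N -> 2^-1 ^+ n * d < e.
Proof.
move=> d0 e0; have dE := RRe_real (ger0_real d0).
have eE := RRe_real (gtr0_real e0); move: d0 e0; rewrite -dE -eE.
move: (complex.Re d) (complex.Re e) => {d e dE eE} d e.
rewrite lecR ltcR => d0 e0; exists (Num.Def.archi_bound (d / e)) => n.
move=> /upper_nthrootP; rewrite ltr_pdivrMr// => lt.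
rewrite -ltcR rmorphM rmorphXn/= rmorph_nat in lt.
by rewrite exprVn mulrC ltr_pdivrMr ?exprn_gt0// mulrC.
Qed.

(** A zero of [f] closer to x than |f x| / (k + 1) would give |f x| < |f x|. *)
Lemma closed_zeros (V W : normedModType C) (f : V -> W) (k : C) : 0 <= k ->
  (forall x y, `|f x - f y| <= k * `|x - y|) -> closed [set x | f x = 0].
Proof.
move=> k0 fk x xcl; apply/eqP/negPn/negP => fx0.
have e0 : 0 < `|f x| / (k + 1) by rewrite divr_gt0 ?normr_gt0// ltr_wpDl.
have [y /= [fy]] := xcl _ (nbhsx_ballx x _ e0).
rewrite -ball_normE /= ltr_pdivlMr ?ltr_wpDl// => lt.
have := fk x y; rewrite fy subr0 => le.
suff : `|f x| < `|f x| by rewrite ltxx.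
apply: le_lt_trans le _; apply: le_lt_trans lt.
by rewrite mulrC ler_wpM2l// lerDl.
Qed.

Lemma closed_norm_le (V : normedModType C) (r : C) : r \is Num.real ->
  closed [set x : V | `|x| <= r].
Proof.
move=> rr x xcl; rewrite /= real_leNgt ?normr_real//; apply/negP => lt.
have e0 : 0 < `|x| - r by rewrite subr_gt0.
have [y /= [yr]] := xcl _ (nbhsx_ballx x _ e0).
rewrite -ball_normE /= => h.
have /le_lt_trans := ler_distD y x 0; rewrite !subr0 => /(_ _ (ltr_leD h yr)).
by rewrite subrK ltxx.
Qed.

(** Banach iteration inside [U]; it is used to solve 2 y = h^2 + y^2. *)
Lemma half_contraction_fixpoint (V : completeNormedModType C) (U : set V)
    (f : V -> V) (x0 : V) : closed U -> U x0 -> (forall x, U x -> U (f x)) ->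
  (forall x y, U x -> U y -> `|f x - f y| <= 2^-1 * `|x - y|) ->
  exists2 p, U p & f p = p.
Proof.
move=> clU Ux0 fU fc; pose u n := iter n f x0.
have Uu n : U (u n) by elim: n => //= n; exact: fU.
pose d := `|u 1%N - u 0%N|.
have step n : `|u n.+1 - u n| <= 2^-1 ^+ n * d.
  elim: n => [|n IH]; first by rewrite expr0 mul1r.
  rewrite exprS -mulrA; apply: le_trans (fc _ _ (Uu n.+1) (Uu n)) _.
  by rewrite ler_wpM2l.
have dist n m : `|u (n + m)%N - u n| <= 2^-1 ^+ n * (2 * d).
  (* The exact partial sum of the geometric series, rather than its bound 2, makes the induction on
     [m] go through. *)
  have : `|u (n + m)%N - u n| <= 2^-1 ^+ n * ((2 - 2 * 2^-1 ^+ m) * d).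
    elim: m => [|m IH].
      by rewrite addn0 subrr normr0 expr0 mulr1 subrr mul0r mulr0.
    apply: le_trans (ler_distD (u (n + m)%N) _ _) _.
    rewrite addnS; apply: le_trans (lerD (step _) IH) _.
    rewrite exprD -mulrA -mulrDr ler_wpM2l ?exprn_ge0// -mulrDl.
    rewrite ler_wpM2r ?normr_ge0// exprS mulrA divff ?pnatr_eq0// mul1r.
    by rewrite le_eqVlt; apply/orP; left; apply/eqP; ring.
  move/le_trans; apply; rewrite ler_wpM2l ?exprn_ge0//.
  rewrite ler_wpM2r ?normr_ge0// gerBl mulr_ge0// exprn_ge0.
have cau : cvg (u n @[n --> \oo]).
  apply/cauchy_cvgP; apply: cauchy_exP => e e0.
  have [|N NP] := @complex_half_geometric_small (2 * d) e _ e0.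
    by rewrite mulr_ge0 ?normr_ge0.
  exists (u N); exists N => // n /= Nn; rewrite -ball_normE /= distrC.
  by rewrite -(subnKC Nn); apply: le_lt_trans (dist _ _) (NP _ _).
have Ul : U (lim (u n @[n --> \oo])).
  by apply: closed_cvg cau => //; exact: nearW.
exists (lim (u n @[n --> \oo])) => //; set l := lim _.
have /cvgrPdist_lt lP : u n @[n --> \oo] --> l by [].
apply/eqP; rewrite -subr_eq0 -normr_le0; apply/ler_addgt0Pr => e e0.
have [N _ NP] := lP (e / 2) (divr_gt0 e0 (ltr0n _ 2)).
have h1 := ltW (NP N (leqnn _)); have h2 := ltW (NP N.+1 (leqnSn _)).
rewrite add0r [e]splitr; apply: le_trans (ler_distD (u N.+1) _ _) _.
apply: lerD; last by rewrite distrC.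
apply: le_trans (fc _ _ Ul (Uu N)) _.
apply: le_trans h1; rewrite ler_piMl ?normr_ge0// invf_le1// ler1n//.
Qed.
End Topology.

(** * C*-algebras and unital *-homomorphisms *)

Section CstarBasics.
Variables (R : realType) (D : cstarType R).
Implicit Types x y z : D.

Lemma cmul0l x : 0 ** x = 0.
Proof. by have := cmulZl 0 0 x; rewrite !scale0r. Qed.
Lemma cmul0r x : x ** 0 = 0.
Proof. by have := cmulZr 0 x 0; rewrite !scale0r. Qed.
Lemma cmulNl x y : (- x) ** y = - (x ** y).
Proof. by rewrite -[- x]scaleN1r cmulZl scaleN1r. Qed.
Lemma cmulNr x y : x ** (- y) = - (x ** y).
Proof. by rewrite -[- y]scaleN1r cmulZr scaleN1r. Qed.
Lemma cmulBl x y z : (x - y) ** z = x ** z - y ** z.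
Proof. by rewrite cmulDl cmulNl. Qed.
Lemma cmulBr x y z : z ** (x - y) = z ** x - z ** y.
Proof. by rewrite cmulDr cmulNr. Qed.
Lemma star0 : star (0 : D) = 0.
Proof. by have := starZ 0 (0 : D); rewrite rmorph0 !scale0r. Qed.
Lemma starN x : star (- x) = - star x.
Proof. by rewrite -scaleN1r starZ rmorphN1 scaleN1r. Qed.
Lemma starB x y : star (x - y) = star x - star y.
Proof. by rewrite starD starN. Qed.
Lemma cstar_mul_suml (I : Type) (r : seq I) (F : I -> D) x :
  (\sum_(i <- r) F i) ** x = \sum_(i <- r) F i ** x.
Proof. by elim/big_rec2 : _ => [|i y z _ <-]; rewrite ?cmul0l ?cmulDl. Qed.
Lemma cstar_mul_sumr (I : Type) (r : seq I) (F : I -> D) x :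
  x ** (\sum_(i <- r) F i) = \sum_(i <- r) x ** F i.
Proof. by elim/big_rec2 : _ => [|i y z _ <-]; rewrite ?cmul0r ?cmulDr. Qed.
Lemma cstar_star_sum (I : Type) (r : seq I) (F : I -> D) :
  star (\sum_(i <- r) F i) = \sum_(i <- r) star (F i).
Proof. by elim/big_rec2 : _ => [|i y z _ <-]; rewrite ?star0 ?starD. Qed.

(** The C*-identity gives |y|^2 = |y^* y| <= |y^*| |y|; cancel |y|, then apply this to both x and
    x^* . *)
Lemma norm_star x : `|star x| = `|x|.
Proof.
have le y : `|y| <= `|star y|.
  have [->|y0] := eqVneq y 0; first by rewrite star0.
  have := norm_cmul (star y) y; rewrite norm_cstar expr2.
  by rewrite ler_pM2r// normr_gt0.
by apply/eqP; rewrite eq_le le andbT -{2}(starK x) le.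
Qed.

Lemma cstar_eq0 x : star x ** x = 0 -> x = 0.
Proof.
move=> /(congr1 Num.norm); rewrite norm_cstar normr0 => /eqP.
by rewrite expf_eq0 /= normr_eq0 => /eqP.
Qed.

Lemma closed_unit_law x : closed [set y | x ** y = y /\ y ** x = y].
Proof.
rewrite [X in closed X](_ : _ =
    [set y | x ** y - y = 0] `&` [set y | y ** x - y = 0]).
  have bd (f : D -> D) : (forall y z, f (y - z) = f y - f z) ->
      (forall y, `|f y| <= `|x| * `|y|) ->
      forall y z, `|(f y - y) - (f z - z)| <= (`|x| + 1) * `|y - z|.
    move=> fB fb y z.
    have -> : f y - y - (f z - z) = f (y - z) - (y - z).
      by rewrite fB !opprD !opprK addrACA.
    by rewrite mulrDl mul1r; apply: le_trans (ler_normB _ _) _; rewrite lerD.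
  have x0 : 0 <= `|x| + 1 by rewrite addr_ge0.
  apply: closedI; apply: (closed_zeros x0); apply: bd => [y z|y].
  - exact: cmulBr.
  - exact: norm_cmul.
  - exact: cmulBl.
  - by rewrite mulrC norm_cmul.
by apply/seteqP; split=> y /=; [move=> [-> ->]; rewrite subrr|
  move=> [/eqP + /eqP]; rewrite !subr_eq0 => /eqP + /eqP].
Qed.
End CstarBasics.

Lemma star_cone (R : realType) (D : unitalCstarType R) : star (cone : D) = cone.
Proof. by rewrite -[LHS]cmul1r -{2}[cone]starK -starM cmul1r starK. Qed.

Section StarHom.
Variables (R : realType) (D D' : cstarType R) (f : D -> D').
Hypothesis fhom : star_hom f.
Lemma star_hom_linear : linear f. Proof. by case: fhom. Qed.
Lemma star_homM x y : f (x ** y) = f x ** f y. Proof. by case: fhom. Qed.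
Lemma star_homS x : f (star x) = star (f x). Proof. by case: fhom. Qed.
Lemma star_homZ a x : f (a *: x) = a *: f x.
Proof. exact: linear_scale star_hom_linear. Qed.
Lemma star_homD x y : f (x + y) = f x + f y.
Proof. by have := star_hom_linear 1 x y; rewrite !scale1r. Qed.
Lemma star_homB x y : f (x - y) = f x - f y.
Proof. by rewrite star_homD -scaleN1r star_homZ scaleN1r. Qed.
Lemma star_hom0 : f 0 = 0.
Proof. by rewrite -(subrr 0) star_homB subrr. Qed.
End StarHom.

(** * Boundedness of unital *-homomorphisms *)

Section AutomaticContinuity.
Variables (R : realType).
Local Notation C := R[i].

Lemma norm_cone_le1 (D : unitalCstarType R) : `|cone : D| <= 1.
Proof.
have [->|D0] := eqVneq (cone : D) 0; first by rewrite normr0.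
have := norm_cstar (cone : D); rewrite star_cone cmul1l => /eqP.
by rewrite -{1}[`|cone|]mulr1 expr2 (inj_eq (mulfI _)) ?normr_eq0// => /eqP <-.
Qed.

(* h is the real part of the unitary h + i k. *)
Lemma norm_le1_of_squares (D : unitalCstarType R) (h k : D) :
  star h = h -> star k = k -> h ** k = k ** h -> h ** h + k ** k = cone ->
  `|h| <= 1.
Proof.
move=> hs ks hk h2k2; pose u := h + 'i *: k.
have us : star u = h - 'i *: k by rewrite starD starZ hs ks conjCi scaleNr.
have u1 : star u ** u = cone.
  rewrite us cmulBl !cmulDr !cmulZr !cmulZl hk scalerA -expr2 sqrCi scaleN1r.
  by rewrite opprD opprK addrA addrK.
have n1 : `|u| <= 1.
  rewrite -(@ler_pXn2r _ 2) ?nnegrE// expr1n -norm_cstar u1.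
  exact: norm_cone_le1.
have -> : h = 2^-1 *: (u + star u).
  rewrite us addrACA subrr addr0 -mulr2n -[h *+ 2]scaler_nat scalerA.
  by rewrite mulVf ?scale1r ?pnatr_eq0.
rewrite normrZ; apply: le_trans (ler_wpM2l _ (ler_normD _ _)) _ => //.
rewrite norm_star ger0_norm ?invr_ge0// mulrC ler_pdivrMr// mul1r.
by rewrite -[2]/(1 + 1) lerD.
Qed.

(** With k = 1 - y the equation h^2 + k^2 = 1 reads y = (h^2 + y^2) / 2. On the self-adjoint y of
    norm at most 1/2 that commute with h, the right side is a contraction with constant 1/2. *)
Lemma square_root_one_minus_square (D : unitalCstarType R) (h : D) :
  star h = h -> `|h| <= 2^-1 ->
  exists k, [/\ star k = k, h ** k = k ** h & h ** h + k ** k = cone].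
Proof.
move=> hs h2.
pose U := [set y : D | [/\ star y = y, h ** y = y ** h & `|y| <= 2^-1]].
pose g (y : D) : D := 2^-1 *: (h ** h + y ** y).
have half0 : 0 <= 2^-1 :> C by rewrite invr_ge0.
have half1 : `|2^-1 : C| = 2^-1 by rewrite ger0_norm.
have hh : 2^-1 * (2^-1 + 2^-1) = 2^-1 :> C by field.
have bd (y z : D) (r : C) :
    `|y| <= 2^-1 -> `|z| <= r -> 0 <= r -> `|y ** z| <= 2^-1 * r.
  by move=> y2 zr r0; apply: le_trans (norm_cmul _ _) _; apply: ler_pM.
have [|||y z|y [ys yh _] gy] := @half_contraction_fixpoint _ D U g 0.
- rewrite [U](_ : _ = [set y | star y - y = 0] `&` [set y | h ** y - y ** h = 0]
      `&` [set y | `|y| <= 2^-1]).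
    apply: closedI; last exact: closed_norm_le (ger0_real half0).
    apply: closedI.
      apply: (@closed_zeros _ _ _ _ 2) => // y z.
      have -> : star y - y - (star z - z) = star (y - z) - (y - z).
        by rewrite starB !opprD !opprK addrACA.
      apply: le_trans (ler_normB _ _) _.
      by rewrite norm_star mulr_natl mulr2n.
    apply: (@closed_zeros _ _ _ _ 1) => // y z.
    have -> : h ** y - y ** h - (h ** z - z ** h) = h ** (y - z) - (y - z) ** h.
      by rewrite cmulBr cmulBl !opprD !opprK addrACA.
    apply: le_trans (ler_normB _ _) _; rewrite mul1r [leRHS]splitr.
    apply: lerD; apply: le_trans (norm_cmul _ _) _; last by rewrite ler_wpM2l.
    by rewrite [leRHS]mulrC ler_wpM2r.
  apply/seteqP; split=> y /=; first by move=> [-> -> ->]; rewrite !subrr.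
  by move=> [[/eqP + /eqP]]; rewrite !subr_eq0 => /eqP + /eqP.
- by split; rewrite ?star0 ?cmul0l ?cmul0r ?normr0.
- move=> y [ys yh y2]; split.
  + by rewrite starZ starD !starM hs ys geC0_conj.
  + by rewrite cmulZr cmulZl cmulDr cmulDl !cmulA yh -!cmulA yh.
  + rewrite normrZ half1 -[leRHS]hh ler_wpM2l//.
    apply: le_trans (ler_normD _ _) _; apply: lerD.
      by apply: le_trans (bd _ _ _ h2 h2 half0) _; rewrite ler_piMr// invf_le1 ?ler1n.
    by apply: le_trans (bd _ _ _ y2 y2 half0) _; rewrite ler_piMr// invf_le1 ?ler1n.
- move=> [_ _ y2] [_ _ z2].
  have -> : g y - g z = 2^-1 *: (y ** (y - z) + (y - z) ** z).
    rewrite -scalerBr opprD addrACA subrr add0r cmulBr cmulBl.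
    by rewrite addrA subrK.
  rewrite normrZ half1 ler_wpM2l//; apply: le_trans (ler_normD _ _) _.
  rewrite [X in _ <= X]splitr; apply: lerD.
    by apply: le_trans (bd _ _ _ y2 (lexx _) _) _; rewrite // mulrC.
  by apply: le_trans (norm_cmul _ _) _; rewrite ler_wpM2l.
exists (cone - y); split.
- by rewrite starB ys star_cone.
- by rewrite cmulBr cmulBl cmul1l cmul1r yh.
- have {}gy : h ** h + y ** y = y + y.
    have := congr1 (fun z => 2 *: z) gy.
    rewrite scalerA divff ?pnatr_eq0// scale1r => ->.
    by rewrite scaler_nat mulr2n.
  rewrite cmulBl !cmulBr !cmul1l cmul1r opprB addrCA.
  by rewrite (addrA (h ** h)) gy addrK subrK.
Qed.

(** A self-adjoint h is scaled to norm 1/2, where the square root exists; its image then has norm at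
    most 1, whence the factor 2. The C*-identity passes from x^* x to x. *)
Lemma unital_star_hom_bounded (D D' : unitalCstarType R) (f : D -> D') :
  star_hom f -> f cone = cone -> forall x, `|f x| <= 2 * `|x|.
Proof.
move=> fh f1.
have sa h : star h = h -> `|f h| <= 2 * `|h|.
  move=> hs; have [->|h0] := eqVneq h 0.
    by rewrite (star_hom0 fh) !normr0 mulr0.
  have h0' : 0 < 2 * `|h| by rewrite mulr_gt0 ?normr_gt0.
  pose c : C := (2 * `|h|)^-1.
  have c0 : 0 < c by rewrite invr_gt0.
  have [||k [ks hk hk2]] := @square_root_one_minus_square D (c *: h).
  - by rewrite starZ hs geC0_conj// ltW.
  - rewrite normrZ gtr0_norm// /c invfM -mulrA mulVf ?mulr1 ?normr_eq0//.
  have : `|f (c *: h)| <= 1.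
    apply: (@norm_le1_of_squares _ _ (f k)).
    - by rewrite -(star_homS fh) starZ hs geC0_conj// ltW.
    - by rewrite -(star_homS fh) ks.
    - by rewrite -!(star_homM fh) hk.
    - by rewrite -!(star_homM fh) -(star_homD fh) hk2.
  by rewrite (star_homZ fh) normrZ gtr0_norm// mulrC ler_pdivrMr// mul1r.
move=> x; rewrite -(@ler_pXn2r _ 2) ?nnegrE ?mulr_ge0//.
rewrite -norm_cstar -(star_homS fh) -(star_homM fh).
apply: le_trans (sa _ _) _; first by rewrite starM starK.
rewrite norm_cstar exprMn ler_wpM2r ?exprn_ge0// expr2.
by rewrite ler_peMr// ler1n.
Qed.

Lemma closed_star_hom_kernel (D D' : unitalCstarType R) (f : D -> D') :
  star_hom f -> f cone = cone -> closed [set x | f x = 0].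
Proof.
move=> fh f1; apply: (@closed_zeros _ _ _ _ 2) => // x y.
by rewrite -(star_homB fh); exact: unital_star_hom_bounded.
Qed.
End AutomaticContinuity.

(** * The dual frame of the comultiplication *)

Lemma scaler_swap (K : fieldType) (V : lmodType K) (c d : K) (v : V) :
  c *: (d *: v) = d *: (c *: v).
Proof. by rewrite !scalerA mulrC. Qed.

Section Bilinear.
Variable K : fieldType.
Implicit Types U V W : lmodType K.

Definition bilinear_map U V W (f : U -> V -> W) : Prop :=
  (forall u, linear (f u)) /\ (forall v, linear (f^~ v)).

Lemma tliftE_bilinear (U V : vectType K) W (f : U -> V -> W) u v :
  bilinear_map f -> tlift f (tens u v) = f u v.
Proof. by case=> fr fl; exact: tliftE. Qed.

Lemma tens_delta (U V : vectType K) i j :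
  delta_mx i j = tens (vbasis {:U})`_i (vbasis {:V})`_j.
Proof.
apply/matrixP => k l; rewrite !mxE !coord_free ?(basis_free (vbasisP _))//.
by rewrite -natrM mulnb (eq_sym k) (eq_sym l).
Qed.

Lemma tens_sum (U V : vectType K) (T : U ⊗ V) :
  T = \sum_i \sum_j T i j *: tens (vbasis {:U})`_i (vbasis {:V})`_j.
Proof.
rewrite {1}[T]matrix_sum_delta; apply: eq_bigr => i _; apply: eq_bigr => j _.
by rewrite tens_delta.
Qed.

Lemma tens_ext (U V : vectType K) W (F G : U ⊗ V -> W) :
  linear F -> linear G -> (forall u v, F (tens u v) = G (tens u v)) ->
  forall T, F T = G T.
Proof.
move=> lF lG FG T; rewrite (tens_sum T) (linear_bigsum _ _ lF).
rewrite (linear_bigsum _ _ lG); apply: eq_bigr => i _.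
rewrite (linear_comb _ _ _ lF) (linear_comb _ _ _ lG).
by apply: eq_bigr => j _; rewrite FG.
Qed.

Lemma bilinear_suml U V W (f : U -> V -> W) (I : Type) (r : seq I)
    (c : I -> K) (F : I -> U) v : bilinear_map f ->
  f (\sum_(i <- r) c i *: F i) v = \sum_(i <- r) c i *: f (F i) v.
Proof. by case=> _ fl; rewrite (linear_comb _ _ _ (fl v)). Qed.

Lemma bilinear_sumr U V W (f : U -> V -> W) (I : Type) (r : seq I)
    (c : I -> K) (F : I -> V) u : bilinear_map f ->
  f u (\sum_(i <- r) c i *: F i) = \sum_(i <- r) c i *: f u (F i).
Proof. by case=> fr _; rewrite (linear_comb _ _ _ (fr u)). Qed.
End Bilinear.

Lemma cmul_bilinear (R : realType) (D : cstarType R) :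
  bilinear_map (fun x y : D => x ** y).
Proof. by split=> [x a y z|x a y z]; rewrite ?cmulDr ?cmulDl ?cmulZr ?cmulZl. Qed.

(* Polarization: x^* x, (x + 1)^* (x + 1) and (i x + 1)^* (i x + 1). *)
Lemma hermitian_of_positive (R : realType) (B : unitalCstarType R)
    (V : lmodType R[i]) (L : B -> V) (sigma : V -> V) :
  linear L -> {morph sigma : u v / u + v} ->
  (forall a u, sigma (a *: u) = a^* *: sigma u) ->
  (forall x, sigma (L (star x ** x)) = L (star x ** x)) ->
  forall x, L (star x) = sigma (L x).
Proof.
move=> lL sD sZ sL x.
have LZ := linear_scale _ _ lL.
have LD u v : L (u + v) = L u + L v by have := lL 1 u v; rewrite !scale1r.
have s11 : sigma (L cone) = L cone.
  by have := sL cone; rewrite star_cone cmul1r.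
have re y : sigma (L (star y)) + sigma (L y) = L (star y) + L y.
  have := sL (y + cone); rewrite starD star_cone cmulDl !cmulDr !cmul1l cmul1r.
  by rewrite !LD !sD sL s11 -!addrA => /addrI; rewrite !addrA => /addIr.
have := re ('i *: x); rewrite starZ !LZ !sZ conjCK conjCi.
rewrite !scaleNr -scalerBr [RHS]addrC -scalerBr.
move=> /(scalerI (neq0Ci _)) im.
have : sigma (L (star x)) + sigma (L x) - (sigma (L (star x)) - sigma (L x))
    = L (star x) + L x - (L x - L (star x)) by rewrite re im.
rewrite !opprD !opprK addrACA subrr add0r [RHS]addrA addrK -!mulr2n.
rewrite -[LHS]scaler_nat -[RHS]scaler_nat => /(congr1 (fun u => 2^-1 *: u)).
by rewrite !scalerA mulVf ?pnatr_eq0// !scale1r => ->.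
Qed.

Section DualFrame.
Variables (R : realType) (B : finCstarType R) (psi : {scalar B}).
Local Notation C := R[i].
Hypothesis psi_state : faithful_state psi.

Lemma state_star x : psi (star x) = (psi x)^*.
Proof.
apply: (@hermitian_of_positive _ _ C^o psi Num.conj).
- exact: linearP.
- exact: rmorphD.
- by move=> a u; rewrite rmorphM.
- by case: psi_state => p _ _ y; rewrite geC0_conj.
Qed.

Lemma state_nondegenerate y : (forall x, psi (x ** y) = 0) -> y = 0.
Proof. by case: psi_state => _ _ inj h; apply: inj. Qed.

Lemma tip_tens s t (T : B ⊗ B) :
  tip psi (tens s t) T = tlift (fun c d => ip psi s c * ip psi t d : C^o) T.
Proof.
apply: (@tliftcE _ _ _ C^o) => [a x y z|a x y z];
  rewrite /tlift scaler_sumr -big_split; apply: eq_bigr => i _;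
  rewrite scaler_sumr -big_split; apply: eq_bigr => j _ /=;
  rewrite /ip starD starZ cmulDl cmulZl linearD scalarZ /GRing.scale /=; ring.
Qed.

Lemma comul_unique x (T : B ⊗ B) :
  (forall s t, tip psi (tens s t) T = ip psi (s ** t) x) -> T = comul psi x.
Proof.
move=> h; apply/eqP; rewrite -subr_eq0; apply/eqP; apply: (tip_nondeg psi_state).
move=> i j; rewrite tens_delta tip_tens -scaleN1r addrC tlift_linear -!tip_tens.
rewrite comulP// h /tmul tliftE_bilinear; last exact: cmul_bilinear.
by rewrite scaleN1r addNr.
Qed.

(* The b_i are the basis dual to the a_i for the form psi (x y). *)
Definition dual_frame n (a b : 'I_n -> B) : Prop :=
  (forall x, \sum_i psi (x ** a i) *: b i = x) /\
  (forall x, \sum_i psi (b i ** x) *: a i = x).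

(** The a_i form the chosen basis and the b_i collect the coefficients of m^* (1). *)
Lemma dual_frame_exists : exists n (a b : 'I_n -> B), dual_frame a b.
Proof.
pose M := comul psi cone; pose e := vbasis {:B}.
exists (\dim {:B}), (fun i => e`_i), (fun i => \sum_j M i j *: e`_j).
set a := fun i : 'I__ => e`_i; set b := fun i : 'I__ => _.
(* The defining property of m^* (1), tested against s^* ⊗ t^* . *)
have ab s t : \sum_i psi (s ** a i) * psi (t ** b i) = psi (t ** s).
  have := comulP psi_state cone (tens (star s) (star t)).
  rewrite -/M /tmul tliftE_bilinear; last exact: cmul_bilinear.
  rewrite tip_tens /ip starM !starK cmul1r => <-; apply: eq_bigr => i _.
  rewrite cstar_mul_sumr linear_sum mulr_sumr; apply: eq_bigr => j _.
  by rewrite cmulZr scalarZ mulrCA.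
have F1 x : \sum_i psi (x ** a i) *: b i = x.
  apply/eqP; rewrite -subr_eq0; apply/eqP/state_nondegenerate => t.
  rewrite cmulBr linearB -[psi (t ** x)]ab cstar_mul_sumr linear_sum -sumrB.
  rewrite big1// => i _.
  by rewrite cmulZr scalarZ subrr.
split=> // x; apply/eqP; rewrite -subr_eq0; apply/eqP/state_nondegenerate => t.
rewrite cmulBr linearB -{2}[t]F1 cstar_mul_sumr cstar_mul_suml !linear_sum.
rewrite -big_split big1 //= => i _.
by rewrite cmulZr cmulZl !scalarZ mulrC subrr.
Qed.

Section Frame.
Variables (n : nat) (a b : 'I_n -> B).
Hypothesis ab : dual_frame a b.
Variable W : lmodType C.
Implicit Types f : B -> B -> W.

(** Expand x a_i in the a_j and b_j x in the b_i: both have coefficients psi (b_j x a_i).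
    Quantifying over bilinear [f] replaces equality in B ⊗ B. *)
Lemma dual_frame_move f x : bilinear_map f ->
  \sum_i f (x ** a i) (b i) = \sum_i f (a i) (b i ** x).
Proof.
move=> bf; under eq_bigr => i _ do rewrite -[x ** a i](ab.2) (bilinear_suml _ _ _ _ bf).
rewrite exchange_big; apply: eq_bigr => j _ /=.
rewrite -[X in _ = f _ X](ab.1) (bilinear_sumr _ _ _ _ bf).
by apply: eq_bigr => i _; rewrite cmulA.
Qed.

(** Since psi is hermitian, taking adjoints turns the expansion of b_j^* in the a_i into one of b_j
    in the a_i^* . *)
Lemma dual_frame_flip f : bilinear_map f ->
  \sum_i f (star (b i)) (star (a i)) = \sum_i f (a i) (b i).
Proof.
move=> bf.
under eq_bigr => i _ do rewrite -[star (b i)](ab.2) (bilinear_suml _ _ _ _ bf).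
rewrite exchange_big; apply: eq_bigr => j _ /=.
rewrite -(bilinear_sumr _ _ _ _ bf); congr (f _ _).
rewrite -[RHS]starK -(ab.2 (star (b j))) cstar_star_sum; apply: eq_bigr => i _.
by rewrite starZ -state_star starM starK.
Qed.
End Frame.

Section FrameComul.
Variables (n : nat) (a b : 'I_n -> B).
Hypothesis ab : dual_frame a b.

Lemma comul_dual_frame x : comul psi x = \sum_i tens (x ** a i) (b i).
Proof.
apply/esym/comul_unique => s t; rewrite tip_tens.
rewrite (linear_bigsum _ _ (tlift_linear _)) /ip starM.
transitivity (\sum_i psi (star s ** (x ** a i)) * psi (star t ** b i)).
  apply: eq_bigr => i _; rewrite tliftE// => u c v w /=.
    by rewrite /ip cmulDr cmulZr linearD scalarZ /GRing.scale /=; ring.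
  by rewrite /ip cmulDr cmulZr linearD scalarZ /GRing.scale /=; ring.
rewrite -cmulA -[star s ** x](ab.1) cstar_mul_sumr linear_sum.
by apply: eq_bigr => i _; rewrite cmulZr scalarZ cmulA.
Qed.

Lemma tlift_comul (W : lmodType C) (f : B -> B -> W) x : bilinear_map f ->
  tlift f (comul psi x) = \sum_i f (x ** a i) (b i).
Proof.
move=> bf; rewrite comul_dual_frame (linear_bigsum _ _ (tlift_linear _)).
by apply: eq_bigr => i _; rewrite tliftE_bilinear.
Qed.

Lemma quantum_adjacency_frame (A : {linear B -> B}) delta x :
  quantum_adjacency psi delta A ->
  \sum_i A (x ** a i) ** A (b i) = (delta%:C%C ^+ 2) *: A x.
Proof.
move=> <-; rewrite /tmul /tmap comul_dual_frame.
rewrite (linear_bigsum _ _ (tlift_linear (fun u v => tens (A u) (A v)))).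
rewrite (linear_bigsum _ _ (tlift_linear _)); apply: eq_bigr => i _.
rewrite tliftE_bilinear ?tliftE_bilinear//; first exact: cmul_bilinear.
by split=> [u c v w|u c v w]; rewrite linearP ?tens_linearr ?tens_linearl.
Qed.
End FrameComul.
End DualFrame.

(** On 1 x 1 matrices, A (y^* y) is again of the form Y^* Y, hence self-adjoint; polarization does
    the rest. *)
Lemma completely_positive_star (R : realType) (B : finCstarType R)
    (A : {linear B -> B}) x : completely_positive A -> A (star x) = star (A x).
Proof.
move=> cpA; apply: (@hermitian_of_positive _ _ B A star).
- exact: linearP.
- exact: starD.
- exact: starZ.
- move=> y; have [|Y /matrixP/(_ 0 0)] := cpA 1%N (\matrix_(i, j) (star y ** y)).
    by exists (\matrix_(i, j) y); apply/matrixP => i j; rewrite !mxE big_ord1 !mxE.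
  by rewrite !mxE big_ord1 => ->; rewrite starM starK.
Qed.

(** * The quantum edge correspondence *)

Section CentralProjection.
Variables (R : realType) (B : finCstarType R) (psi : {scalar B}).
Local Notation C := R[i].
Hypothesis psi_state : faithful_state psi.

(** Solves the normal equations; the Gram matrix is invertible because psi is faithful. *)
Lemma orthogonal_projection_exists (V : {vspace B}) (y : B) :
  exists2 z, z \in V & forall x, x \in V -> psi (star x ** z) = psi (star x ** y).
Proof.
pose X := vbasis V.
pose G : 'M[C]_(\dim V) := \matrix_(i, j) psi (star X`_j ** X`_i).
pose comb (c : 'rV[C]_(\dim V)) := \sum_i c 0 i *: X`_i.
have combG c j : (c *m G) 0 j = psi (star X`_j ** comb c).
  rewrite mxE cstar_mul_sumr linear_sum; apply: eq_bigr => i _.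
  by rewrite mxE cmulZr scalarZ.
have psi_ext u v : (forall j : 'I_(\dim V),
    psi (star X`_j ** u) = psi (star X`_j ** v)) ->
    forall x, x \in V -> psi (star x ** u) = psi (star x ** v).
  move=> h x xV; rewrite (coord_vbasis xV) cstar_star_sum !cstar_mul_suml.
  rewrite !linear_sum; apply: eq_bigr => i _.
  by rewrite starZ !cmulZl !scalarZ h.
have combV c : comb c \in V.
  by apply: memv_suml => i _; apply/memvZ/vbasis_mem/mem_nth; rewrite size_tuple.
have Gunit : G \in unitmx.
  rewrite -row_free_unit -kermx_eq0; apply/rowV0P => c /sub_kermxP cG0.
  apply/rowP => i; rewrite mxE.
  have c0 : comb c = 0.
    case: psi_state => _ _; apply; rewrite (psi_ext _ 0) ?cmul0r ?linear0// => j.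
    by rewrite -combG cG0 mxE cmul0r linear0.
  have /freeP : free X by exact: basis_free (vbasisP V).
  by apply; exact: c0.
pose v : 'rV[C]_(\dim V) := \row_j psi (star X`_j ** y).
exists (comb (v *m invmx G)) => // x; apply: psi_ext => j.
by rewrite -combG mulmxKV// mxE.
Qed.

(* The projection z of 1 onto the ideal satisfies x^* z = x^* for x in the     *)
(* ideal, since psi (b^* x^* (1 - z)) = 0 for all b; hence z is its unit.     *)
Lemma ideal_central_projection (V : {vspace B}) :
  (forall x y, y \in V -> x ** y \in V) ->
  (forall x y, y \in V -> y ** x \in V) ->
  exists z, [/\ z \in V, central_projection z & forall x, x \in V -> z ** x = x].
Proof.
move=> Vl Vr; have [z zV zP] := orthogonal_projection_exists V cone.
have xz x : x \in V -> star x ** z = star x.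
  move=> xV; apply/eqP; rewrite -subr_eq0; apply/eqP.
  apply: (state_nondegenerate psi_state) => y.
  rewrite cmulBr linearB cmulA -[y]starK -starM zP ?Vr// cmul1r.
  by rewrite subrr.
have zs : star z = z.
  by rewrite -[LHS](xz _ zV) -{2}[z]starK -starM (xz _ zV) starK.
have zx x : x \in V -> z ** x = x.
  by move=> xV; rewrite -[LHS]starK starM zs xz// starK.
exists z; split=> //; split=> //; first exact: zx.
have bz y : y ** z = z ** (y ** z) by rewrite zx// Vl.
by move=> y; rewrite [RHS]bz cmulA -[LHS]starK starM zs bz !starM !starK zs.
Qed.

(** The u with A (w u x) = 0 for all w, x form a two-sided ideal. Its unit z is a central projection
    with A (z x) = 0 for all x, so z = 0 by hypothesis and the ideal is zero. *)
Lemma ideal_kernel_eq0 (A : {linear B -> B}) y :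
  ~ ker_contains_central_summand A ->
  (forall w x, A (w ** y ** x) = 0) -> y = 0.
Proof.
move=> kerA Ay; pose e := vbasis {:B}.
(* Testing w and x on a basis presents the ideal as the kernel of one linear map, hence as a
   [vspace]. *)
pose F (u : B) : {ffun 'I_(\dim {:B}) * 'I_(\dim {:B}) -> B} :=
  [ffun p : 'I__ * 'I__ => A (e`_p.1 ** u ** e`_p.2)].
have lF : linear F.
  move=> c u v; apply/ffunP => p; rewrite !ffunE.
  by rewrite cmulDr cmulDl cmulZr cmulZl linearP.
pose gm := GRing.isLinear.Build _ _ _ _ _ lF.
pose FL : {linear B -> {ffun 'I_(\dim {:B}) * 'I_(\dim {:B}) -> B}} :=
  HB.pack F gm.
have memF u : reflect (forall w x, A (w ** u ** x) = 0) (u \in lker (linfun FL)).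
  rewrite memv_ker lfunE; apply: (iffP eqP) => [/ffunP Fu w x|h].
    rewrite (coord_vbasis (memvf w)) !cstar_mul_suml linear_sum big1// => i _.
    rewrite (coord_vbasis (memvf x)) cstar_mul_sumr linear_sum big1// => j _.
    have := Fu (i, j); rewrite !ffunE /= => h.
    by rewrite cmulZr !cmulZl !linearZ /= h !scaler0.
  by apply/ffunP => p; rewrite !ffunE h.
have [||z [/memF zF zc zV]] := @ideal_central_projection (lker (linfun FL)).
- by move=> x u /memF h; apply/memF => w v; rewrite cmulA h.
- by move=> x u /memF h; apply/memF => w v; rewrite cmulA -cmulA h.
have [z0|z0] := eqVneq z 0.
  have /memF/zV : forall w x, A (w ** y ** x) = 0 by [].
  by rewrite z0 cmul0l.
case: kerA; exists z; split=> //; first exact/eqP.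
by move=> x; have := zF cone x; rewrite cmul1l.
Qed.
End CentralProjection.

Lemma linear_comp_subvs (K : fieldType) (T : vectType K) (V : {vspace T})
    (W : lmodType K) (f : T -> W) :
  linear f -> linear (fun xi : subvs_of V => f (vsval xi)).
Proof. by move=> lf c u v; rewrite linearP lf. Qed.

(** * Generators x . eps . y of the edge correspondence *)

Section EdgeCorrespondence.
Variables (R : realType) (B : finCstarType R) (psi : {scalar B}).
Variables (A : {linear B -> B}) (delta : R).
Local Notation C := R[i].
Local Notation X := (edge_correspondence psi A delta).
Local Notation eps := (edge_indicator psi A delta).
Local Notation E := (edge_space psi A delta).

(* Locked, lest unification unfold it together with the module actions. *)
Definition edge : B -> B -> X :=
  locked (fun x y => vsproj E (tens_ract (tens_lact x eps) y)).

Lemma edgeE x y : edge x y = vsproj E (tens_ract (tens_lact x eps) y).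
Proof. by rewrite /edge; unlock. Qed.

Lemma edge_val x y : vsval (edge x y) = tens_ract (tens_lact x eps) y.
Proof.
rewrite edgeE; apply: vsprojK; apply/mem_edge_space.
by exists 1%N, (fun=> x), (fun=> y); rewrite big_ord1.
Qed.

Lemma edge_lact z x y : lact z (edge x y) = edge (z ** x) y.
Proof. by rewrite /= edge_val !edgeE tens_lract tens_lactM. Qed.

Lemma edge_ract x y z : ract (edge x y) z = edge x (y ** z).
Proof. by rewrite /= edge_val !edgeE tens_ractM. Qed.

Lemma edge_linearl y : linear (edge^~ y).
Proof.
by move=> c u v; rewrite !edgeE tens_lact_linearl tens_ract_linear linearP.
Qed.

Lemma edge_linearr x : linear (edge x).
Proof. by move=> c u v; rewrite !edgeE tens_ract_linearr linearP. Qed.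

Lemma edge_sum (xi : X) : exists n (x y : 'I_n -> B), xi = \sum_k edge (x k) (y k).
Proof.
have [n [x [y xiE]]] := (mem_edge_space _ _ _ _).1 (subvsP xi).
exists n, x, y; apply: val_inj; rewrite /= xiE linear_sum.
by apply: eq_bigr => k _; rewrite /= edge_val.
Qed.

(** Only additivity is asked, so that this also serves the conjugate-linear variable of the inner
    product. *)
Lemma edge_ext (W : zmodType) (F G : X -> W) :
  {morph F : u v / u + v} -> {morph G : u v / u + v} ->
  (forall x y, F (edge x y) = G (edge x y)) -> forall xi, F xi = G xi.
Proof.
move=> FD GD FG xi; have [n [x [y ->]]] := edge_sum xi.
have F0 (H : X -> W) : {morph H : u v / u + v} -> H 0 = 0.
  by move=> HD; apply: (@addrI _ (H 0)); rewrite -HD !addr0.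
by elim/big_rec: _ => [|i z _ IH]; rewrite ?F0// FD GD IH FG.
Qed.

Lemma edge_lact_linear x : linear (@lact _ _ X x).
Proof.
apply: (linear_comp_subvs (f := fun T => vsproj E (tens_lact x T))) => c u v.
by rewrite tens_lact_linear linearP.
Qed.

Lemma edge_ract_linear y : linear (fun xi : X => ract xi y).
Proof.
apply: (linear_comp_subvs (f := fun T => vsproj E (tens_ract T y))) => c u v.
by rewrite tens_ract_linear linearP.
Qed.

Lemma edge_ract_linearr (xi : X) : linear (ract xi).
Proof.
by move=> c u v; rewrite /= tens_ract_linearr linearP.
Qed.

Lemma tens_ip_linearr (S : B ⊗ B) : linear (tens_ip psi S).
Proof.
move=> c u v; rewrite /tens_ip /tliftc scaler_sumr -big_split.
apply: eq_bigr => i _; rewrite scaler_sumr -big_split; apply: eq_bigr => j _ /=.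
by rewrite tlift_linear scalerDr !scalerA mulrC.
Qed.

Lemma tens_ip_conjl (T : B ⊗ B) (c : C) (u v : B ⊗ B) :
  tens_ip psi (c *: u + v) T = c^* *: tens_ip psi u T + tens_ip psi v T.
Proof.
rewrite /tens_ip /tliftc scaler_sumr -big_split.
apply: eq_bigr => i _; rewrite scaler_sumr -big_split; apply: eq_bigr => j _ /=.
by rewrite !mxE rmorphD rmorphM scalerDl scalerA.
Qed.

Lemma tens_ip_addl (T : B ⊗ B) :
  {morph (fun S : B ⊗ B => tens_ip psi S T) : u v / u + v}.
Proof. by move=> u v; have := tens_ip_conjl T 1 u v; rewrite rmorph1 !scale1r. Qed.

Lemma tens_ip_suml (I : Type) (r : seq I) (c : C) (F : I -> B ⊗ B) (T : B ⊗ B) :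
  tens_ip psi (c *: \sum_(i <- r) F i) T = c^* *: \sum_(i <- r) tens_ip psi (F i) T.
Proof.
have T0 : tens_ip psi 0 T = 0.
  by apply: (@addrI _ (tens_ip psi 0 T)); rewrite -tens_ip_addl !addr0.
rewrite -[c *: _]addr0 tens_ip_conjl T0 addr0; congr (_ *: _).
exact: (big_morph _ (tens_ip_addl T) T0).
Qed.

Lemma tens_ip_tens s t u v :
  tens_ip psi (tens s t) (tens u v) = psi (star s ** u) *: (star t ** v).
Proof.
rewrite /tens_ip tliftcE => [|c x y z|c x y z]; first apply: tliftE_bilinear.
- split=> [w c x y|w c x y]; rewrite cmulDr cmulZr.
    by rewrite scalerDr !scalerA mulrC.
  by rewrite linearD scalarZ scalerDl scalerA.
- rewrite /tlift scaler_sumr -big_split; apply: eq_bigr => i _.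
  rewrite scaler_sumr -big_split; apply: eq_bigr => j _ /=.
  rewrite starD starZ cmulDl cmulZl linearD scalarZ scalerDl scalerDr !scalerA.
  by congr (_ *: _ + _); ring.
- rewrite /tlift scaler_sumr -big_split; apply: eq_bigr => i _.
  rewrite scaler_sumr -big_split; apply: eq_bigr => j _ /=.
  rewrite starD starZ cmulDl cmulZl !scalerDr !scalerA.
  by congr (_ *: _ + _); ring.
Qed.

Lemma edge_ip_linearr (xi : X) : linear (corr_ip xi).
Proof. exact: (linear_comp_subvs (tens_ip_linearr (vsval xi))). Qed.

Lemma edge_ip_conjl (eta : X) (c : C) (u v : X) :
  corr_ip (c *: u + v) eta = c^* *: corr_ip u eta + corr_ip v eta.
Proof. by rewrite /= -tens_ip_conjl; congr tens_ip; exact: linearP. Qed.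

Lemma edge_ip_addl (eta : X) :
  {morph (fun xi : X => corr_ip xi eta) : u v / u + v}.
Proof. by move=> u v; rewrite /= -tens_ip_addl; congr tens_ip; exact: linearD. Qed.
End EdgeCorrespondence.

(** * Inner products and the frame of the edge correspondence *)

Section EdgeFrame.
Variables (R : realType) (B : finCstarType R) (psi : {scalar B}).
Variables (A : {linear B -> B}) (delta : R).
Local Notation C := R[i].
Local Notation d2 := (delta%:C%C ^- 2 : C).
Local Notation X := (edge_correspondence psi A delta).
Local Notation edge := (@edge R B psi A delta).
Hypothesis psi_state : faithful_state psi.
Hypothesis delta_gt0 : 0 < delta.
Hypothesis A_adj : quantum_adjacency psi delta A.
Hypothesis A_cp : completely_positive A.
Variables (n : nat) (a b : 'I_n -> B).
Hypothesis ab : dual_frame psi a b.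

Lemma delta2_neq0 : delta%:C%C ^+ 2 != 0 :> C.
Proof. by rewrite expf_neq0// gt_eqF// ltcR. Qed.

Lemma delta2_real : (d2 : C)^* = d2.
Proof. by rewrite geC0_conj// invr_ge0 exprn_ge0// lecR ltW. Qed.

Let A_star x : A (star x) = star (A x).
Proof. exact: completely_positive_star. Qed.

Lemma edge_ip_addr (xi : X) : {morph corr_ip xi : u v / u + v}.
Proof. by move=> u v; have := edge_ip_linearr xi 1 u v; rewrite !scale1r. Qed.

Lemma edge_ract_addr (xi : X) : {morph ract xi : u v / u + v}.
Proof. by move=> u v; have := edge_ract_linearr xi 1 u v; rewrite !scale1r. Qed.

Let tens_bilinear2 (F G : B -> B) : linear F -> linear G ->
  bilinear_map (fun u v => tens (F u) (G v)).
Proof.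
move=> lF lG; split=> [u c v w|u c v w].
  by rewrite lG tens_linearr.
by rewrite lF tens_linearl.
Qed.

Lemma edge_val_frame x y :
  vsval (edge x y) = d2 *: \sum_i tens (x ** a i) (A (b i) ** y).
Proof.
rewrite edge_val /edge_indicator (linear_scale _ _ (tens_lact_linear x)).
rewrite (linear_scale _ _ (tens_ract_linear y)); congr (_ *: _).
rewrite /tmap (tlift_comul psi_state ab); last first.
  by apply: tens_bilinear2 => // c u v; rewrite linearP.
rewrite (linear_bigsum _ _ (tens_lact_linear x)).
rewrite (linear_bigsum _ _ (tens_ract_linear y)); apply: eq_bigr => i _.
rewrite /tens_lact /tmap tliftE_bilinear ?cmul1l; last first.
  by apply: tens_bilinear2 => // c u v; rewrite cmulDr cmulZr.
rewrite /tens_ract /tmap tliftE_bilinear//.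
by apply: tens_bilinear2 => // c u v; rewrite cmulDl cmulZl.
Qed.

(** Each eps contributes delta^-2 and one dual frame. One frame sum collapses by duality; the other,
    after a flip and a move, is a quantum adjacency sum, which gives back delta^2. *)
Lemma edge_ip x y x' y' :
  corr_ip (edge x y) (edge x' y') = d2 *: (star y ** A (star x ** x') ** y').
Proof.
rewrite /= !edge_val_frame tens_ip_suml delta2_real; congr (_ *: _).
transitivity (\sum_i star (A (b i) ** y) **
    (d2 *: (A (star (x ** a i) ** x') ** y'))).
  apply: eq_bigr => i _.
  rewrite (linear_scale _ _ (tens_ip_linearr _ _)) cmulZr; congr (_ *: _).
  rewrite (linear_bigsum _ _ (tens_ip_linearr _ _)).
  under eq_bigr => j _ do rewrite tens_ip_tens cmulA -cmulZr.
  rewrite -cstar_mul_sumr -[in RHS](ab.1 (star (x ** a i) ** x')) linear_sum.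
  congr (_ ** _); rewrite cstar_mul_suml; apply: eq_bigr => j _.
  by rewrite linearZ cmulZl.
transitivity (\sum_i star y ** (d2 *: (A (star (b i)) **
    A (star (a i) ** (star x ** x')))) ** y').
  by apply: eq_bigr => i _; rewrite !starM -A_star !(cmulZr, cmulZl) !cmulA.
rewrite -cstar_mul_suml -cstar_mul_sumr; congr (_ ** _ ** _).
pose f u v := d2 *: (A u ** A (v ** (star x ** x'))).
have bf : bilinear_map f.
  by split=> [u c v w|u c v w]; rewrite /f ?cmulDl ?cmulZl !linearP ?cmulDr ?cmulDl
    ?cmulZr ?cmulZl scalerDr !scalerA mulrC.
rewrite (dual_frame_flip psi_state ab bf) /f -scaler_sumr.
have bg : bilinear_map (fun u v => A u ** A v).
  by split=> [u c v w|u c v w]; rewrite linearP ?cmulDr ?cmulDl ?cmulZr ?cmulZl.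
rewrite -(dual_frame_move ab _ bg) (quantum_adjacency_frame psi_state ab _ A_adj).
by rewrite scalerA mulVf ?delta2_neq0// scale1r.
Qed.

Lemma edge_ip_star (xi eta : X) : star (corr_ip xi eta) = corr_ip eta xi.
Proof.
move: xi; apply: edge_ext => [u v|u v|x y].
- by rewrite edge_ip_addl starD.
- exact: edge_ip_addr.
move: eta; apply: edge_ext => [u v|u v|x' y'].
- by rewrite edge_ip_addr starD.
- exact: edge_ip_addl.
by rewrite !edge_ip starZ delta2_real !starM -A_star starM !starK cmulA.
Qed.

Lemma edge_ip_ract (xi eta : X) y : corr_ip xi (ract eta y) = corr_ip xi eta ** y.
Proof.
rewrite -[LHS]edge_ip_star -[corr_ip xi eta]edge_ip_star.
move: xi; apply: edge_ext => [u v|u v|x z].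
- by rewrite (edge_ip_addr _ u v) starD.
- by rewrite (edge_ip_addr _ u v) starD cmulDl.
move: eta; apply: edge_ext => [u v|u v|x' y'].
- rewrite -starD -edge_ip_addl; congr (star (corr_ip _ _)).
  by have := edge_ract_linear y 1 u v; rewrite !scale1r.
- by rewrite edge_ip_addl starD cmulDl.
by rewrite edge_ract !edge_ip_star !edge_ip cmulZl cmulA.
Qed.

(** On x . eps . y the coefficients are delta^-2 A (b_i x) y. Moving factors across both frames
    leaves the sum over i of A (b_j x a_i) A (b_i), which quantum adjacency evaluates. *)
Lemma edge_frame (xi : X) :
  \sum_i ract (edge (a i) cone) (corr_ip (edge (star (b i)) cone) xi) = xi.
Proof.
move: xi; apply: edge_ext => // [u v|x y].
  rewrite -big_split; apply: eq_bigr => i _.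
  by rewrite edge_ip_addr edge_ract_addr.
under eq_bigr => i _ do rewrite edge_ip star_cone cmul1l starK edge_ract cmul1l.
pose f u v := edge u (d2 *: (A v ** y)).
have bf : bilinear_map f.
  split=> [u c v w|u c v w]; rewrite /f.
    rewrite linearP cmulDl cmulZl scalerDr scalerA mulrC -scalerA.
    by rewrite edge_linearr.
  by rewrite edge_linearl.
rewrite -(dual_frame_move ab x bf) /f; apply: val_inj => /=.
rewrite linear_sum /= [RHS]edge_val_frame.
under eq_bigr => i _ do rewrite edge_val_frame.
rewrite -scaler_sumr; congr (_ *: _).
have bh z w : bilinear_map (fun u v : B => tens u (A (v ** z) ** w)).
  apply: (@tens_bilinear2 id (fun v => A (v ** z) ** w)) => // c u v.
  by rewrite cmulDl cmulZl linearP cmulDl cmulZl.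
transitivity (\sum_i \sum_j tens (a j) (A (b j ** x ** a i) ** (d2 *: (A (b i) ** y)))).
  apply: eq_bigr => i _; have := dual_frame_move ab (x ** a i) (bh cone _).
  move=> /(_ (d2 *: (A (b i) ** y))); under eq_bigr => j _ do rewrite cmul1r.
  by move=> ->; apply: eq_bigr => j _; rewrite cmul1r cmulA.
rewrite exchange_big /=.
transitivity (\sum_j tens (a j) (A (b j ** x) ** y)); last first.
  have /= := dual_frame_move ab x (bh cone y).
  under eq_bigr => j _ do rewrite cmul1r.
  by move=> ->; apply: eq_bigr => j _; rewrite cmul1r.
apply: eq_bigr => j _; rewrite -(linear_bigsum _ _ (tens_linearr _)).
congr (tens _ _).
under eq_bigr => i _ do rewrite cmulZr cmulA.
rewrite -scaler_sumr -cstar_mul_suml (quantum_adjacency_frame psi_state ab _ A_adj).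
by rewrite cmulZl scalerA mulVf ?delta2_neq0// scale1r.
Qed.

(** If y acts as zero, then 0 = <w^* . eps, y x . eps> = delta^-2 A (w y x) for all w, x. *)
Lemma edge_lact_faithful y : ~ ker_contains_central_summand A ->
  (forall xi : X, lact y xi = 0) -> y = 0.
Proof.
move=> kerA y0; apply: (ideal_kernel_eq0 psi_state kerA) => w x.
have := edge_ip (star w) cone (y ** x) cone.
rewrite -edge_lact y0 starK star_cone cmul1l cmul1r cmulA.
have -> : corr_ip (edge (star w) cone) 0 = 0.
  by apply: (@addrI _ (corr_ip (edge (star w) cone) 0)); rewrite -edge_ip_addr !addr0.
move/(congr1 (fun u => delta%:C%C ^+ 2 *: u)).
by rewrite scaler0 scalerA mulfV ?delta2_neq0// scale1r.
Qed.

(** This is x applied to the frame expansion of a vector. *)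
Lemma edge_lact_theta x :
  lact x = \sum_i theta (edge (x ** a i) cone) (edge (star (b i)) cone) :> (X -> X).
Proof.
apply/funext => xi; rewrite fct_sumE.
have E i : theta (edge (x ** a i) cone) (edge (star (b i)) cone) xi =
    lact x (ract (edge (a i) cone) (corr_ip (edge (star (b i)) cone) xi)).
  set y := corr_ip _ _; rewrite (edge_ract _ _ _ (a i) cone y).
  rewrite edge_lact -(edge_ract psi A delta (x ** a i) cone y).
  by [].
rewrite (eq_bigr _ (fun i _ => E i)) -[xi in LHS]edge_frame.
exact: (linear_bigsum _ _ (edge_lact_linear x)).
Qed.

Lemma edge_katsura x : ~ ker_contains_central_summand A ->
  @katsura_ideal _ _ X x.
Proof.
move=> kerA; split; last by move=> y /(edge_lact_faithful kerA) ->; rewrite cmul0r.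
by exists n, (fun i => edge (x ** a i) cone), (fun i => edge (star (b i)) cone);
  exact: edge_lact_theta.
Qed.
Lemma edge_ract_add y : {morph (fun xi : X => ract xi y) : u v / u + v}.
Proof. by move=> u v; have := edge_ract_linear y 1 u v; rewrite !scale1r. Qed.

Lemma edge_lact_add x : {morph @lact _ _ X x : u v / u + v}.
Proof. by move=> u v; have := edge_lact_linear x 1 u v; rewrite !scale1r. Qed.

Lemma edge_ract1 (xi : X) : ract xi cone = xi.
Proof.
move: xi; apply: edge_ext => [u v|//|x w]; first exact: edge_ract_add.
by rewrite edge_ract cmul1r.
Qed.

Lemma edge_lact1 (xi : X) : lact cone xi = xi.
Proof.
move: xi; apply: edge_ext => [u v|//|x w]; first exact: edge_lact_add.
by rewrite edge_lact cmul1l.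
Qed.

Lemma theta_linear (xi eta : X) : linear (theta xi eta).
Proof. by move=> c u v; rewrite /theta edge_ip_linearr edge_ract_linearr. Qed.

Lemma compact_linear (T : X -> X) : compact_op T -> linear T.
Proof.
move=> [m [xi [eta ->]]] c u v; rewrite !fct_sumE scaler_sumr -big_split.
by apply: eq_bigr => i _; rewrite theta_linear.
Qed.

Lemma edge_frame_flip (xi : X) :
  \sum_i ract (edge (star (b i)) cone) (corr_ip (edge (a i) cone) xi) = xi.
Proof.
pose f u v := ract (edge u cone) (corr_ip (edge (star v) cone) xi).
have bf : bilinear_map f.
  split=> [u c v w|v c u w]; last by rewrite /f edge_linearl edge_ract_linear.
  by rewrite /f starD starZ edge_linearl edge_ip_conjl conjCK edge_ract_linearr.
transitivity (\sum_i f (star (b i)) (star (a i))).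
  by apply: eq_bigr => i _; rewrite /f starK.
rewrite (dual_frame_flip psi_state ab bf); exact: edge_frame.
Qed.

Lemma compact_theta_sum (I : Type) (r : seq I) (xi eta : I -> X) :
  compact_op (\sum_(i <- r) theta (xi i) (eta i)).
Proof.
exists (size r), (fun k => xi (tnth (in_tuple r) k)),
  (fun k => eta (tnth (in_tuple r) k)).
exact: big_tnth.
Qed.

(** * Representations and the map psi_t *)

Section Representation.
Variables (D : cstarType R) (pi : B -> D) (t : X -> D).
Hypothesis rep : is_representation pi t.

Let pih : star_hom pi. Proof. by case: rep. Qed.
Let tl : linear t. Proof. by case: rep. Qed.
Let tt xi eta : star (t xi) ** t eta = pi (corr_ip xi eta).
Proof. by case: rep. Qed.

(** The difference d of the two sides satisfies d^* t(eta) = 0 for all eta, hence d^* d = 0. *)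
Lemma representation_ract xi y : t (ract xi y) = t xi ** pi y.
Proof.
have ipl u : corr_ip (ract xi y) u = star y ** corr_ip xi u.
  by rewrite -edge_ip_star edge_ip_ract starM edge_ip_star.
set e := t xi ** pi y.
have e0 eta : star (t (ract xi y) - e) ** t eta = 0.
  rewrite starB cmulBl starM -cmulA !tt ipl -(star_homS pih) -(star_homM pih).
  by rewrite subrr.
apply/eqP; rewrite -subr_eq0; apply/eqP/cstar_eq0.
by rewrite cmulBr e0 cmulA e0 cmul0l subrr.
Qed.

(** A compact T is the sum of the theta (T (a_i . eps)) (b_i^* . eps). Reading psi_t off this
    expansion avoids choosing a decomposition of T. *)
Definition frame_psi_t (T : X -> X) : D :=
  \sum_i t (T (edge (a i) cone)) ** star (t (edge (star (b i)) cone)).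

Lemma frame_psi_t_theta xi eta : frame_psi_t (theta xi eta) = t xi ** star (t eta).
Proof.
rewrite -[eta in RHS]edge_frame_flip (linear_bigsum _ _ tl) cstar_star_sum.
rewrite cstar_mul_sumr; apply: eq_bigr => i _.
rewrite /theta !representation_ract starM -(star_homS pih).
by rewrite edge_ip_star cmulA.
Qed.

Lemma frame_psi_t_sum (I : Type) (r : seq I) (F : I -> X -> X) :
  frame_psi_t (\sum_(i <- r) F i) = \sum_(i <- r) frame_psi_t (F i).
Proof.
rewrite exchange_big; apply: eq_bigr => j _ /=.
by rewrite fct_sumE (linear_bigsum _ _ tl) cstar_mul_suml.
Qed.

Lemma frame_psi_t_mul T zeta : compact_op T ->
  frame_psi_t T ** t zeta = t (T zeta).
Proof.
move=> [m [xi [eta ->]]]; rewrite frame_psi_t_sum cstar_mul_suml.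
rewrite fct_sumE (linear_bigsum _ _ tl); apply: eq_bigr => i _.
by rewrite frame_psi_t_theta -cmulA tt /theta representation_ract.
Qed.

Lemma frame_psi_tP : is_psi_t t frame_psi_t.
Proof.
split=> [c T T' _ _|T T' cT cT'|T T' cT cT' adj|].
- rewrite scaler_sumr -big_split; apply: eq_bigr => i _ /=.
  by rewrite tl cmulDl cmulZl.
- rewrite [in RHS]/frame_psi_t cstar_mul_sumr; apply: eq_bigr => i _ /=.
  by rewrite cmulA frame_psi_t_mul.
(* The frame expansion of T' xi, with T' moved across the inner product, writes T' through T. *)
- have TE : T' = \sum_i theta (edge (a i) cone) (T (edge (star (b i)) cone)).
    apply/funext => xi; rewrite fct_sumE -[LHS]edge_frame.
    by apply: eq_bigr => i _; rewrite /theta adj.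
  rewrite TE frame_psi_t_sum cstar_star_sum.
  under eq_bigr => i _ do rewrite frame_psi_t_theta.
  pose f u v := t (edge u cone) ** star (t (T (edge (star v) cone))).
  have bf : bilinear_map f.
    split=> [u c v w|v c u w]; last by rewrite /f edge_linearl tl cmulDl cmulZl.
    rewrite /f starD starZ edge_linearl (compact_linear cT) tl starD starZ conjCK.
    by rewrite cmulDr cmulZr.
  transitivity (\sum_i f (a i) (b i)) => //.
  rewrite -(dual_frame_flip psi_state ab bf).
  by apply: eq_bigr => i _; rewrite /f starM !starK.
- exact: frame_psi_t_theta.
Qed.

(** The map in [is_covariant] is only known to exist; additivity fixes its value on such sums. *)
Lemma psi_t_theta_sum psi_t (r : seq 'I_n) (xi eta : 'I_n -> X) :
  is_psi_t t psi_t ->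
  psi_t (\sum_(i <- r) theta (xi i) (eta i)) =
  \sum_(i <- r) t (xi i) ** star (t (eta i)).
Proof.
case=> pl _ _ pth; elim: r => [|i r IH].
  have c0 := compact_theta_sum [::] xi eta; rewrite big_nil in c0.
  have := pl 1 _ _ c0 c0; rewrite !scale1r !addr0 !big_nil => h.
  by apply: (@addrI _ (psi_t 0)); rewrite addr0.
rewrite !big_cons -IH -pth -[theta _ _ in LHS]scale1r pl ?scale1r//.
  by have := compact_theta_sum [:: i] xi eta; rewrite big_seq1.
exact: compact_theta_sum.
Qed.

Lemma covariant_frame x : ~ ker_contains_central_summand A -> is_covariant pi t ->
  pi x = \sum_i t (edge (x ** a i) cone) ** star (t (edge (star (b i)) cone)).
Proof.
move=> kerA [psi_t psi_tP ->]; last exact: edge_katsura.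
by rewrite edge_lact_theta (psi_t_theta_sum _ _ _ psi_tP).
Qed.
End Representation.

(** * Local families and representations *)

Section LocalFamily.
Variable D : unitalCstarType R.
Implicit Type s : B -> D.

(* The relations (LQCK1)-(LQCK3) on elementary tensors; local_range s x is     *)
(* mu_D (s ⊗ s^* ) m^* (x).                                                   *)
Definition local_range s x : D := \sum_i s (x ** a i) ** star (s (star (b i))).

Definition local_family s : Prop :=
  [/\ linear s,
      forall x y, local_range s x ** s y = d2 *: s (x ** y),
      forall x y, star (s (star x)) ** s y = d2 *: local_range s (A (x ** y))
    & local_range s cone = d2 *: cone].

Lemma sstar_linear s : linear s -> linear (sstar s).
Proof.
by move=> sl c u v; rewrite /sstar starD starZ sl starD starZ conjCK.
Qed.

Lemma cmul_comp_bilinear (U V : lmodType C) (f : U -> D) (g : V -> D) :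
  linear f -> linear g -> bilinear_map (fun u v => f u ** g v).
Proof.
move=> lf lg; split=> [u c v w|v c u w].
  by rewrite lg cmulDr cmulZr.
by rewrite lf cmulDl cmulZl.
Qed.

Lemma mu2_tens (f g : B -> D) x y : linear f -> linear g ->
  mu2 f g (tens x y) = f x ** g y.
Proof. by move=> lf lg; rewrite /mu2 tliftE_bilinear//; exact: cmul_comp_bilinear. Qed.

Lemma mu2_comul s x : linear s -> mu2 s (sstar s) (comul psi x) = local_range s x.
Proof.
move=> sl; rewrite /mu2 (tlift_comul psi_state ab)//.
by apply: cmul_comp_bilinear => //; exact: sstar_linear.
Qed.

Lemma comul_linear : linear (comul psi).
Proof.
move=> c u v; rewrite !(comul_dual_frame psi_state ab) scaler_sumr -big_split.
by apply: eq_bigr => i _; rewrite cmulDl cmulZl tens_linearl.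
Qed.

Lemma mu3_tens s x y : linear s ->
  mu3 s (sstar s) s (tmap (comul psi) id (tens x y)) = local_range s x ** s y.
Proof.
move=> sl; rewrite /tmap tliftE_bilinear; last first.
  by split=> [u c v w|v c u w]; rewrite ?tens_linearr// comul_linear tens_linearl.
rewrite /mu3 tliftE_bilinear ?mu2_comul//.
by apply: cmul_comp_bilinear => //; exact: tlift_linear.
Qed.

Lemma tmul_tens x y : tmul (tens x y) = x ** y :> B.
Proof. by rewrite /tmul tliftE_bilinear//; exact: cmul_bilinear. Qed.

Lemma lqck1_defect_tens s x y : linear s ->
  lqck1_defect psi delta s (tens x y) = local_range s x ** s y - d2 *: s (x ** y).
Proof. by move=> sl; rewrite /lqck1_defect mu3_tens// tmul_tens. Qed.

Lemma lqck2_defect_tens s x y : linear s ->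
  lqck2_defect psi A delta s (tens x y) =
  star (s (star x)) ** s y - d2 *: local_range s (A (x ** y)).
Proof.
move=> sl; rewrite /lqck2_defect mu2_tens//; last exact: sstar_linear.
by rewrite tmul_tens mu2_comul.
Qed.

(** The defects are linear in the tensor, so they vanish once they vanish on elementary tensors. *)
Lemma local_familyP s : linear s ->
  local_family s <->
  [/\ forall T, lqck1_defect psi delta s T = 0,
      forall T, lqck2_defect psi A delta s T = 0 & lqck3_defect psi delta s = 0].
Proof.
move=> sl; have lm2 f g : linear (mu2 f g : B ⊗ B -> D) by exact: tlift_linear.
have lm3 f g h : linear (mu3 f g h : (B ⊗ B) ⊗ B -> D) by exact: tlift_linear.
have lm : linear (@tmul R B) by exact: tlift_linear.
have lt : linear (tmap (comul psi) (@id B)) by exact: tlift_linear.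
split=> [[_ h1 h2 h3]|[h1 h2 h3]].
  split; last by rewrite /lqck3_defect mu2_comul// h3 subrr.
    apply: tens_ext => [c u v|c u v|x y].
    - rewrite /lqck1_defect lt lm3 lm sl scalerDr opprD.
      by rewrite scalerBr addrACA !scalerA [c * _]mulrC.
    - by rewrite scaler0 addr0.
    - by rewrite lqck1_defect_tens// h1 subrr.
  apply: tens_ext => [c u v|c u v|x y].
  - rewrite /lqck2_defect lm2 lm linearP comul_linear lm2 scalerDr opprD.
    by rewrite scalerBr addrACA !scalerA [c * _]mulrC.
  - by rewrite scaler0 addr0.
  - by rewrite lqck2_defect_tens// h2 subrr.
split=> // [x y|x y|].
- by apply/eqP; rewrite -subr_eq0 -lqck1_defect_tens// h1.
- by apply/eqP; rewrite -subr_eq0 -lqck2_defect_tens// h2.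
- by apply/eqP; rewrite -subr_eq0 -mu2_comul// -/(lqck3_defect _ _ _) h3.
Qed.

(** Evaluate the first two local relations at T = m^* (x), where m T = delta^2 x cancels
    delta^-2. *)
Lemma local_family_qck s : delta_form psi delta -> local_family s ->
  qck_family psi A delta s.
Proof.
move=> psi_delta sloc; have sl : linear s by case: sloc.
have [h1 h2 h3] := (local_familyP sl).1 sloc.
split=> // [x|x|]; last by apply/eqP; rewrite -subr_eq0; apply/eqP.
- have /eqP := h1 (comul psi x); rewrite /lqck1_defect subr_eq0 => /eqP ->.
  rewrite psi_delta (linear_scale _ _ sl) scalerA mulVf ?delta2_neq0//.
  by rewrite scale1r.
- have /eqP := h2 (comul psi x); rewrite /lqck2_defect subr_eq0 => /eqP ->.
  rewrite psi_delta linearZ /= (linear_scale _ _ comul_linear).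
  rewrite /mu2 (linear_scale _ _ (tlift_linear _)) scalerA mulVf ?delta2_neq0//.
  by rewrite scale1r.
Qed.

Section LocalRepresentation.
Variable s : B -> D.
Hypothesis s_local : local_family s.
Local Notation P := (local_range s).

Let sl : linear s. Proof. by case: s_local. Qed.
Let Ps x y : P x ** s y = d2 *: s (x ** y). Proof. by case: s_local. Qed.
Let ss x y : star (s (star x)) ** s y = d2 *: P (A (x ** y)).
Proof. by case: s_local. Qed.
Let P1 : P cone = d2 *: cone. Proof. by case: s_local. Qed.

Lemma delta_local x : delta%:C%C ^+ 2 *: (d2 *: x) = x :> D.
Proof. by rewrite scalerA mulfV ?delta2_neq0// scale1r. Qed.

Definition local_pi x : D := delta%:C%C ^+ 2 *: P x.
(** The frame expansion defines the map on all of E_G at once, so no well-definedness on sums of x .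
    eps . y has to be checked; [local_t_edge] recovers the expected value. *)
Definition local_t (xi : X) : D :=
  delta%:C%C *: \sum_i s (a i) ** local_pi (corr_ip (edge (star (b i)) cone) xi).

Lemma local_pi_s x y : local_pi x ** s y = s (x ** y).
Proof. by rewrite cmulZl Ps delta_local. Qed.

Lemma local_pi1 : local_pi cone = cone.
Proof. by rewrite /local_pi P1 delta_local. Qed.

Lemma local_piM x y : local_pi (x ** y) = local_pi x ** local_pi y.
Proof.
rewrite [in RHS]/local_pi cmulZr; congr (_ *: _); rewrite cstar_mul_sumr.
by apply: eq_bigr => i _; rewrite cmulA local_pi_s cmulA.
Qed.

Lemma local_pi_linear : linear local_pi.
Proof.
move=> c u v; rewrite /local_pi (scaler_swap c) -scalerDr; congr (_ *: _).
rewrite scaler_sumr -big_split; apply: eq_bigr => i _.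
by rewrite cmulDl cmulZl sl cmulDl cmulZl.
Qed.

(** Moving x^* to the right leg and flipping the frame turns the sum for x^* into the adjoint of the
    sum for x. *)
Lemma local_pi_star x : local_pi (star x) = star (local_pi x).
Proof.
rewrite /local_pi starZ geC0_conj ?exprn_ge0 ?lecR ?ltW//; congr (_ *: _).
rewrite /local_range cstar_star_sum.
pose g u v := s u ** sstar s v.
have bg : bilinear_map g by apply: cmul_comp_bilinear => //; exact: sstar_linear.
rewrite -/(g _ _) (dual_frame_move ab (star x) bg).
pose f u v := g u (v ** star x).
have bf : bilinear_map f.
  split=> [u c v w|v c u w]; rewrite /f; last exact: bg.2.
  by rewrite cmulDl cmulZl; exact: bg.1.
rewrite -[LHS](dual_frame_flip psi_state ab bf); apply: eq_bigr => i _.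
by rewrite /f /g /sstar !starM !starK.
Qed.

Lemma local_pi_hom : star_hom local_pi.
Proof.
by split; [exact: local_pi_linear|exact: local_piM|exact: local_pi_star].
Qed.

Lemma local_t_linear : linear local_t.
Proof.
move=> c u v; rewrite /local_t (scaler_swap c) -scalerDr; congr (_ *: _).
rewrite scaler_sumr -big_split; apply: eq_bigr => i _.
by rewrite edge_ip_linearr local_pi_linear cmulDr cmulZr.
Qed.

(** After x is moved to the a_i, (LQCK2) turns the A (b_i) into s^* (b_i) s(1); the sum is then the
    local range of x times s(1), and (LQCK1) applies. *)
Lemma local_t_edge x y : local_t (edge x y) = delta%:C%C *: (s x ** local_pi y).
Proof.
congr (_ *: _).
under eq_bigr => i _ do rewrite edge_ip starK star_cone cmul1l.
pose f u v := s u ** local_pi (d2 *: (A v ** y)).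
have bf : bilinear_map f.
  apply: (cmul_comp_bilinear sl) => c u v.
  by rewrite linearP cmulDl cmulZl scalerDr (scaler_swap d2) local_pi_linear.
rewrite -(dual_frame_move ab x bf) /f.
(* (LQCK2) at b_i ⊗ 1 reads delta^-2 pi(A (b_i)) = delta^2 s^* (b_i) s(1). *)
transitivity (\sum_i s (x ** a i) ** sstar s (b i) **
    (delta%:C%C ^+ 2 *: s cone) ** local_pi y).
  apply: eq_bigr => i _; rewrite -!cmulA; congr (_ ** _); rewrite !cmulA.
  rewrite (star_homZ local_pi_hom) local_piM -cmulZl; congr (_ ** _).
  rewrite cmulZr /sstar ss cmul1r /local_pi.
  by rewrite !scalerA mulrC.
transitivity (P x ** (delta%:C%C ^+ 2 *: s cone) ** local_pi y).
  by rewrite -!cstar_mul_suml.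
by rewrite (cmulZr _ (P x) (s cone)) Ps delta_local cmul1r.
Qed.

Lemma local_representation : is_representation local_pi local_t.
Proof.
have tD : {morph local_t : u v / u + v}.
  by move=> u v; have := local_t_linear 1 u v; rewrite !scale1r.
have piD := star_homD local_pi_hom.
split=> [||x|xi eta]; [exact: local_pi_hom|exact: local_t_linear| |].
  apply: edge_ext => [u v|u v|y z].
  - by rewrite tD cmulDr.
  - by rewrite edge_lact_add tD.
  - by rewrite edge_lact !local_t_edge cmulZr cmulA local_pi_s.
move: xi; apply: edge_ext => [u v|u v|x y].
- by rewrite tD starD cmulDl.
- by rewrite edge_ip_addl piD.
move: eta; apply: edge_ext => [u v|u v|x' y'].
- by rewrite tD cmulDr.
- by rewrite edge_ip_addr piD.
rewrite edge_ip !local_t_edge starZ cmulZl cmulZr scalerA starM.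
rewrite geC0_conj ?lecR ?ltW// -expr2 -local_pi_star cmulA -(cmulA _ (star _)).
rewrite -[in star (s x)](starK x) ss !(star_homZ local_pi_hom) !local_piM.
by rewrite /local_pi !(cmulZl, cmulZr) !scalerA; congr (_ *: _); ring.
Qed.

(** [frame_psi_t] at the left action of x is the sum defining [local_pi x]: the two factors delta of
    [local_t] make its delta^2. *)
Lemma local_covariant : is_covariant local_pi local_t.
Proof.
exists (frame_psi_t local_t); first exact: (frame_psi_tP local_representation).
move=> x _; rewrite /local_pi scaler_sumr; apply: eq_bigr => i _.
rewrite edge_lact !local_t_edge local_pi1 !cmul1r starZ cmulZl cmulZr scalerA.
by rewrite geC0_conj ?lecR ?ltW// -expr2.
Qed.
End LocalRepresentation.

(** [covariant_frame] identifies the local range with delta^-2 pi; the three relations are then the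
    left module law, the inner product formula and pi(1) = 1. *)
Lemma representation_local_family (pi : B -> D) (t : X -> D) :
  ~ ker_contains_central_summand A ->
  is_representation pi t -> is_covariant pi t -> pi cone = cone ->
  let s x := delta%:C%C^-1 *: t (edge x cone) in
  local_family s /\ forall x, local_range s x = d2 *: pi x.
Proof.
move=> kerA rep cov pi1 s; have [pih tl pit tt] := rep.
have Pd x : local_range s x = d2 *: pi x.
  rewrite (covariant_frame x kerA cov) scaler_sumr; apply: eq_bigr => i _.
  rewrite /s starZ cmulZl cmulZr scalerA geC0_conj ?invr_ge0 ?lecR ?ltW//.
  by rewrite -expr2 exprVn.
split=> //; split=> [c u v|x y|x y|].
- by rewrite /s edge_linearl tl scalerDr !scalerA mulrC.
- rewrite Pd /s cmulZl cmulZr pit edge_lact !scalerA.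
  by [].
- rewrite Pd /s starZ cmulZl cmulZr tt edge_ip star_cone cmul1l cmul1r starK.
  rewrite (star_homZ pih) !scalerA geC0_conj ?invr_ge0 ?lecR ?ltW//.
  by rewrite -expr2 exprVn.
- by rewrite Pd pi1.
Qed.
End LocalFamily.
End EdgeFrame.

(** * The isomorphism *)

(* D is destructed so that the C*-algebra underlying U is convertible to it. *)
Lemma unital_cstar_ind (R : realType) (P : forall D : cstarType R, D -> Prop) :
  (forall U : unitalCstarType R, P U (cone : U)) ->
  forall (D : cstarType R) (o : D), left_id o cmul -> right_id o cmul -> P D o.
Proof.
move=> PU D; case: D => T c; case: c; intros.
pose D := CstarAlgebra.Pack (CstarAlgebra.Class Defs_isCstarAlgebra_mixin).
pose m : isUnitalCstar R D := isUnitalCstar.Build R D H H0.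
pose U := UnitalCstar.Pack (UnitalCstar.Class m).
exact: (PU U).
Qed.

(** * Families and defects under unital *-homomorphisms *)

Section Pushforward.
Variables (R : realType) (B : finCstarType R) (psi : {scalar B}).
Variables (A : B -> B) (delta : R) (D D' : unitalCstarType R) (q : D -> D').
Hypotheses (qh : star_hom q) (q1 : q cone = cone).
Local Notation C := R[i].

Lemma star_hom_tlift (U V : vectType C) (f : U -> V -> D) (T : U ⊗ V) :
  q (tlift f T) = tlift (fun u v => q (f u v)) T.
Proof.
have ql := star_hom_linear qh; rewrite /tlift (linear_bigsum _ _ ql).
by apply: eq_bigr => i _; rewrite (linear_comb _ _ _ ql).
Qed.

Lemma star_hom_mu2 (f g : B -> D) T : q (mu2 f g T) = mu2 (q \o f) (q \o g) T.
Proof.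
rewrite /mu2 star_hom_tlift; congr (tlift _ T); apply/funext => u.
by apply/funext => v; rewrite (star_homM qh).
Qed.

Lemma star_hom_mu3 (f g h : B -> D) T :
  q (mu3 f g h T) = mu3 (q \o f) (q \o g) (q \o h) T.
Proof.
rewrite /mu3 star_hom_tlift; congr (tlift _ T); apply/funext => u.
by apply/funext => v; rewrite (star_homM qh) star_hom_mu2.
Qed.

Lemma star_hom_sstar (s : B -> D) : q \o sstar s = sstar (q \o s).
Proof. by apply/funext => x; rewrite /= /sstar -(star_homS qh). Qed.

Lemma qck_family_comp (s : B -> D) :
  qck_family psi A delta s -> qck_family psi A delta (q \o s).
Proof.
move=> [sl s1 s2 s3]; split=> [c u v|x|x|].
- by rewrite /= sl (star_hom_linear qh).
- by rewrite -star_hom_sstar -star_hom_mu3 s1.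
- by rewrite -star_hom_sstar -!star_hom_mu2 s2.
- by rewrite -star_hom_sstar -star_hom_mu2 s3 (star_homZ qh) q1.
Qed.

Lemma lqck1_defect_comp (s : B -> D) T :
  lqck1_defect psi delta (q \o s) T = q (lqck1_defect psi delta s T).
Proof.
by rewrite /lqck1_defect (star_homB qh) (star_homZ qh) star_hom_mu3 star_hom_sstar.
Qed.

Lemma lqck2_defect_comp (s : B -> D) T :
  lqck2_defect psi A delta (q \o s) T = q (lqck2_defect psi A delta s T).
Proof.
by rewrite /lqck2_defect (star_homB qh) (star_homZ qh) !star_hom_mu2 star_hom_sstar.
Qed.

Lemma lqck3_defect_comp (s : B -> D) :
  lqck3_defect psi delta (q \o s) = q (lqck3_defect psi delta s).
Proof.
by rewrite /lqck3_defect (star_homB qh) (star_homZ qh) q1 star_hom_mu2 star_hom_sstar.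
Qed.
End Pushforward.

(** The elements on which pi(1) acts as a unit form a closed *-subalgebra containing the
    generators. *)
Lemma cuntz_pimsner_unit (R : realType) (B : finCstarType R) (psi : {scalar B})
    (A : {linear B -> B}) (delta : R) (OE : cstarType R) (piE : B -> OE)
    (tE : edge_correspondence psi A delta -> OE) :
  faithful_state psi -> 0 < delta -> quantum_adjacency psi delta A ->
  completely_positive A -> is_cuntz_pimsner piE tE ->
  forall x, piE cone ** x = x /\ x ** piE cone = x.
Proof.
move=> psi_state delta_gt0 A_adj A_cp [rep cov gen _] x.
have [n [a [b ab]]] := dual_frame_exists psi_state.
have [pih _ pit _] := rep; set e := piE cone.
have es : star e = e by rewrite -(star_homS pih) star_cone.
suff : cstar_generated (range piE `|` range tE) `<=` [set y | e ** y = y /\ y ** e = y].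
  by apply; rewrite gen.
apply: smallest_sub.
  split; first exact: closed_unit_law.
  - by rewrite /= cmul0l cmul0r.
  - move=> c y z [ey ye] [ez ze]; rewrite /= cmulDl cmulDr cmulZl cmulZr.
    by rewrite ey ye ez ze.
  - by move=> y z [ey ye] [ez ze] /=; rewrite cmulA ey -cmulA ze.
  - by move=> y [ey ye] /=; rewrite -{1 2}es -!starM ye ey.
move=> y [[z _ <-]|[xi _ <-]] /=.
  by rewrite -!(star_homM pih) cmul1l cmul1r.
rewrite pit edge_lact1; split=> //.
by rewrite -(representation_ract psi_state delta_gt0 A_adj A_cp ab rep) edge_ract1.
Qed.

Lemma unital_quotient_iso (R : realType)
  (B : finCstarType R) (psi : {scalar B}) (A : {linear B -> B}) (delta : R)
  (psi_state : faithful_state psi) (delta_gt0 : 0 < delta)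
  (psi_delta : delta_form psi delta) (A_adj : quantum_adjacency psi delta A)
  (A_cp : completely_positive A) (kerA : ~ ker_contains_central_summand A)
  (OE : unitalCstarType R) (piE : B -> OE)
  (tE : edge_correspondence psi A delta -> OE)
  (OE_univ : is_cuntz_pimsner piE tE) (piE1 : piE cone = cone)
  (OG : unitalCstarType R) (S : B -> OG)
  (OG_univ : is_quantum_cuntz_krieger psi A delta S)
  (Q : unitalCstarType R) (q : OG -> Q) (q1 : q cone = cone)
  (Q_quot : is_quotient (local_relation_ideal psi A delta S) q) :
  cstar_iso OE Q.
Proof.
have [n [a [b ab]]] := dual_frame_exists psi_state.
have [repE covE _ univE] := OE_univ.
have [SQ _ univG] := OG_univ.
have [qh qsurj qker] := Q_quot.
have [_ tl _ _] := repE.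
pose I := local_relation_ideal psi A delta S.
have defect0 (d : OG) : (range (lqck1_defect psi delta S)
    `|` range (lqck2_defect psi A delta S)
    `|` [set lqck3_defect psi delta S]) d -> q d = 0.
  by move=> dX; apply/qker; move: d dX; exact: sub_gen_smallest.
have sl : linear (q \o S).
  by case: (qck_family_comp qh q1 SQ).
have sloc : local_family A delta a b (q \o S).
  apply/(local_familyP A delta psi_state ab) => //; split=> [T|T|].
  - by rewrite lqck1_defect_comp// defect0//; left; left; exists T.
  - by rewrite lqck2_defect_comp// defect0//; left; right; exists T.
  - by rewrite lqck3_defect_comp// defect0//; right.
have repQ := local_representation psi_state delta_gt0 A_adj A_cp ab sloc.
have covQ := local_covariant psi_state delta_gt0 A_adj A_cp ab sloc.
have [rho [[rhoh rhopi rhot] _]] := univE _ _ _ repQ covQ.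
pose sE x := delta%:C%C^-1 *: tE (edge psi A delta x cone).
have [sEloc sErange] := representation_local_family psi_state delta_gt0 A_adj
  A_cp ab kerA repE covE piE1.
have sEl : linear sE by case: sEloc.
have [rho' [[rho'h rho'1 rho'S] _]] :=
  univG _ _ (local_family_qck psi_state delta_gt0 ab psi_delta sEloc).
have {}rho'S : rho' \o S = sE by [].
(* Both maps send S to q S, so uniqueness for O(G) applies. *)
have rho_rho' : rho \o rho' = q.
  have [r [_ runiq]] := univG _ _ (qck_family_comp qh q1 SQ).
  rewrite -(runiq q) ?(runiq (rho \o rho'))//; split.
  - split=> [c x y|x y|x] /=.
    + by rewrite (star_hom_linear rho'h) (star_hom_linear rhoh).
    + by rewrite (star_homM rho'h) (star_homM rhoh).
    + by rewrite (star_homS rho'h) (star_homS rhoh).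
  - rewrite /= rho'1 -piE1; have /= -> := congr1 (@^~ cone) rhopi.
    exact: (local_pi1 delta_gt0 sloc).
  - apply/funext => x /=; have /= -> := congr1 (@^~ x) rho'S.
    rewrite (star_homZ rhoh); have /= -> := congr1 (@^~ (edge psi A delta x cone)) rhot.
    rewrite (local_t_edge psi_state delta_gt0 A_adj A_cp ab sloc).
    rewrite (local_pi1 delta_gt0 sloc) cmul1r scalerA mulVf ?scale1r//.
    by rewrite gt_eqF// ltcR.
(* The kernel of [rho'] is a closed ideal, and it contains the defects because [sE] is a local
   family. *)
have kerrho' x : I x -> rho' x = 0.
  move: x; apply: smallest_sub.
    split; first exact: closed_star_hom_kernel rho'h rho'1.
    - exact: star_hom0 rho'h.
    - by move=> c x y /= x0 y0; rewrite (star_hom_linear rho'h) x0 y0 scaler0 addr0.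
    - by move=> x y /= y0; rewrite !(star_homM rho'h) y0 cmul0l cmul0r.
  have [h1 h2 h3] := (local_familyP A delta psi_state ab sEl).1 sEloc.
  move: h1 h2 h3; rewrite -rho'S => h1 h2 h3.
  by move=> d [[[T _ <-]|[T _ <-]]| ->] /=;
    rewrite -?(lqck1_defect_comp _ _ rho'h) -?(lqck2_defect_comp _ _ _ rho'h)
      -?(lqck3_defect_comp _ _ rho'h).
have [g gP] := choice qsurj.
(* The factorization of [rho'] through [q], via a set-theoretic section [g]; it turns out inverse to
   [rho]. *)
pose sigma y := rho' (g y).
have sigmaq x : sigma (q x) = rho' x.
  apply/eqP; rewrite -subr_eq0 -(star_homB rho'h); apply/eqP/kerrho'/qker.
  by rewrite (star_homB qh) gP subrr.
have sigmah : star_hom sigma.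
  split=> [c x y|x y|x].
  - rewrite -(gP x) -(gP y) -(star_hom_linear qh) !sigmaq.
    exact: star_hom_linear.
  - by rewrite -(gP x) -(gP y) -(star_homM qh) !sigmaq (star_homM rho'h).
  - by rewrite -(gP x) -(star_homS qh) !sigmaq (star_homS rho'h).
have sigmaS x : sigma (q (S x)) = sE x.
  by rewrite sigmaq; have /= -> := congr1 (@^~ x) rho'S.
have sigmapi x : sigma (local_pi delta a b (q \o S) x) = piE x.
  rewrite /local_pi (star_homZ sigmah) (linear_bigsum _ _ (star_hom_linear sigmah)).
  under eq_bigr => i _ do rewrite (star_homM sigmah) (star_homS sigmah) !sigmaS.
  rewrite -/(local_range a b sE x) sErange scalerA mulfV ?scale1r//.
  exact: delta2_neq0.
(* Uniqueness for O_E: both maps fix pi and t on the generators x . eps . y. *)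
have sigma_rho : sigma \o rho = id.
  have [r [_ runiq]] := univE _ _ _ repE covE.
  rewrite -(runiq id) ?(runiq (sigma \o rho))//.
  split.
  - split=> [c x y|x y|x] /=.
    + by rewrite (star_hom_linear rhoh) (star_hom_linear sigmah).
    + by rewrite (star_homM rhoh) (star_homM sigmah).
    + by rewrite (star_homS rhoh) (star_homS sigmah).
  - by apply/funext => x /=; have /= -> := congr1 (@^~ x) rhopi.
  - apply/funext => xi /=; have /= -> := congr1 (@^~ xi) rhot.
    move: xi; apply: edge_ext => [u v|u v|x y].
    + have := local_t_linear (psi := psi) sloc 1 u v; rewrite !scale1r => ->.
      exact: (star_homD sigmah).
    + by have := tl 1 u v; rewrite !scale1r.
    rewrite (local_t_edge psi_state delta_gt0 A_adj A_cp ab sloc).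
    rewrite (star_homZ sigmah) (star_homM sigmah) sigmapi sigmaS cmulZl scalerA.
    rewrite mulfV ?scale1r ?gt_eqF ?ltcR//.
    rewrite -(representation_ract psi_state delta_gt0 A_adj A_cp ab repE).
    by rewrite edge_ract cmul1l.
exists rho; split=> //; exists sigma => [x|y].
  exact: (congr1 (@^~ x) sigma_rho).
by rewrite -(gP y) sigmaq; exact: (congr1 (@^~ (g y)) rho_rho').
Qed.

Theorem corollary3p7 (R : realType)
  (B : finCstarType R) (psi : {scalar B}) (A : {linear B -> B}) (delta : R)
  (psi_state : faithful_state psi)
  (delta_gt0 : 0 < delta)
  (psi_delta : delta_form psi delta)
  (A_adj : quantum_adjacency psi delta A)
  (A_cp : completely_positive A)
  (kerA : ~ ker_contains_central_summand A)
  (OE : cstarType R) (piE : B -> OE)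
  (tE : edge_correspondence psi A delta -> OE)
  (OE_univ : is_cuntz_pimsner piE tE)
  (OG : unitalCstarType R) (S : B -> OG)
  (OG_univ : is_quantum_cuntz_krieger psi A delta S)
  (Q : cstarType R) (q : OG -> Q)
  (Q_quot : is_quotient (local_relation_ideal psi A delta S) q) :
  cstar_iso OE Q.
Proof.
have E1 := cuntz_pimsner_unit psi_state delta_gt0 A_adj A_cp OE_univ.
have El : left_id (piE cone) cmul by move=> x; have [] := E1 x.
have Er : right_id (piE cone) cmul by move=> x; have [] := E1 x.
(* Replaces O_E, and below likewise Q, by unital algebras whose chosen units are pi(1) and q(1). *)
apply: (@unital_cstar_ind R (fun D o => forall (pi : B -> D)
    (t : edge_correspondence psi A delta -> D),
  is_cuntz_pimsner pi t -> pi cone = o -> cstar_iso D Q)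
  _ _ _ El Er piE tE OE_univ erefl).
move=> {El Er E1 OE_univ piE tE OE} OE piE tE OE_univ piE1.
have [qh qsurj _] := Q_quot.
have Ql : left_id (q cone) cmul.
  by move=> y; have [x <-] := qsurj y; rewrite -(star_homM qh) cmul1l.
have Qr : right_id (q cone) cmul.
  by move=> y; have [x <-] := qsurj y; rewrite -(star_homM qh) cmul1r.
apply: (@unital_cstar_ind R (fun D o => forall q : OG -> D,
  is_quotient (local_relation_ideal psi A delta S) q -> q cone = o ->
  cstar_iso OE D) _ _ _ Ql Qr q Q_quot erefl).
move=> {Ql Qr Q_quot qh qsurj q Q} Q q Q_quot q1.
exact: (unital_quotient_iso psi_state delta_gt0 psi_delta A_adj A_cp kerA
  OE_univ piE1 OG_univ q1 Q_quot).
Qed.
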